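(* The category of finite discs, that is, the opposite category $\Theta^{\mathrm{op}}$ of the category $\Theta$ of simple $\omega$-categories, is equivalent to the following category. The objects are coaugmented cochain complexes of free abelian groups with prescribed non-empty finite ordered (graded) bases $c_0,\ldots,c_p$ such that $|c_0|=|c_p|=0$ and such that $|c_q|-|c_{q-1}|=\pm 1$ for $1\leq q\leq p$. The coaugmentation $\eta$ is such that $\eta(1)$ is the sum of the $0$-dimensional basis elements. The coboundary $\delta$ is given by $\delta c_q=\delta^+c_q-\delta^-c_q$, where $\delta^+c_q$ is the sum of the $(|c_q|+1)$-dimensional basis elements $c_r$ with $r<q$ such that $|c_t|>|c_q|$ for $r\leq t<q$, and where $\delta^-c_q$ is the sum of the $(|c_q|+1)$-dimensional basis elements $c_s$ with $q<s$ such that $|c_t|>|c_q|$ for $q<t\leq s$. The morphisms are the coaugmentation-preserving cochain maps taking sums of prescribed basis elements to sums of prescribed basis elements.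
   Context: $\omega$-categories. All $\omega$-categories are strict. An $\omega$-category is a single set with partially defined binary composition operations $\#_0,\#_1,\ldots$, each of which makes it the set of morphisms of a small category. The left identity of $x$ under $\#_n$ is denoted $d_n^-x$ and the right identity $d_n^+x$, so $x\#_n y$ is defined exactly when $d_n^+x=d_n^-y$. The category structures commute with one another (that is, for $m\neq n$ the identity and composition operations of one structure are functorial for the other, including the interchange law), with $d_m^\beta d_n^\alpha x=d_n^\alpha d_m^\beta x=d_m^\beta x$ for $m<n$ and all signs $\alpha,\beta$; and every element $x$ is an identity for some $\#_m$. Morphisms of $\omega$-categories are functions preserving all the identities and composites. A globular set is a set in which every element $x$ has a dimension $|x|\in\{0,1,2,\ldots\}$, every $x$ with $|x|>0$ is assigned two $(|x|-1)$-dimensional elements $\partial^-x,\partial^+x$, and $\partial^-\partial^-x=\partial^-\partial^+x$, $\partial^+\partial^-x=\partial^+\partial^+x$ if $|x|\geq 2$. It is simple if it is non-empty and finite and the transitive closure of the relation given by $\partial^-x<x$ and $x<\partial^+x$ is a (strict) total ordering. The free $\omega$-category on a globular set is the $\omega$-category presented by taking the members of the globular set as generators, with relations $d_n^-x=d_n^+x=x$ for every $n$-dimensional generator $x$, and $d_{n-1}^-x=\partial^-x$, $d_{n-1}^+x=\partial^+x$ for every $n$-dimensional generator $x$ with $n>0$. A simple $\omega$-category is the free $\omega$-category on a simple globular set. $\Theta$ is the full subcategory of the category of $\omega$-categories whose objects are the simple $\omega$-categories. A coaugmented cochain complex is a cochain complex $C^0\to C^1\to\ldots$ of abelian groups in nonnegative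 dimensions with coboundary $\delta$, together with a homomorphism $\eta\colon\mathbf{Z}\to C^0$ such that $\delta\circ\eta=0$. In the claim $|c_q|$ denotes the dimension of the basis element $c_q$. Sums of basis elements may be empty and may have repeated terms. *)

(* Defs.v *)
From HB Require Import structures.
From Stdlib Require Import Relations.
From mathcomp Require Import all_boot all_order all_algebra.
From mathcomp Require Import boolp classical_sets cardinality.

Set Implicit Arguments.
Unset Strict Implicit.
Unset Printing Implicit Defensive.

Import GRing.Theory.
Local Open Scope ring_scope.

(** * Categories *)

Record category := Category {
  obj :> Type;
  hom : obj -> obj -> Type;
  idm : forall A, hom A A;
  comp : forall A B C, hom B C -> hom A B -> hom A C;
  comp1m : forall A B (f : hom A B), comp (idm B) f = f;
  compm1 : forall A B (f : hom A B), comp f (idm A) = f;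
  compmA : forall A B C D (h : hom C D) (g : hom B C) (f : hom A B),
    comp h (comp g f) = comp (comp h g) f
}.

Arguments idm {c} A.
Arguments comp {c A B C} _ _.

Definition opposite (C : category) : category :=
  @Category C (fun A B => @hom C B A) (@idm C)
    (fun _ _ _ g f => comp f g)
    (fun _ _ f => compm1 f) (fun _ _ f => comp1m f)
    (fun _ _ _ _ h g f => esym (compmA f g h)).

Definition full_subcategory (C : category) (P : C -> Prop) : category :=
  @Category {A : C | P A} (fun A B => hom (sval A) (sval B))
    (fun A => idm (sval A)) (fun _ _ _ g f => comp g f)
    (fun _ _ f => comp1m f) (fun _ _ f => compm1 f)
    (fun _ _ _ _ h g f => compmA h g f).

Record functor (C D : category) := Functor {
  fobj :> C -> D;
  fmap : forall A B, hom A B -> hom (fobj A) (fobj B);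
  fmap1 : forall A, fmap (idm A) = idm (fobj A);
  fmapD : forall A B E (g : hom B E) (f : hom A B),
    fmap (comp g f) = comp (fmap g) (fmap f)
}.

Definition functor_id (C : category) : functor C C :=
  @Functor C C id (fun _ _ f => f) (fun _ => erefl) (fun _ _ _ _ _ => erefl).

Lemma functor_comp_id (C D E : category) (G : functor D E) (F : functor C D)
  (A : C) : fmap G (fmap F (idm A)) = idm (G (F A)).
Proof. by rewrite !fmap1. Qed.

Lemma functor_comp_comp (C D E : category) (G : functor D E) (F : functor C D)
  (A B X : C) (g : hom B X) (f : hom A B) :
  fmap G (fmap F (comp g f)) = comp (fmap G (fmap F g)) (fmap G (fmap F f)).
Proof. by rewrite !fmapD. Qed.

Definition functor_comp (C D E : category) (G : functor D E) (F : functor C D) :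
  functor C E :=
  @Functor C E (fun A => G (F A)) (fun _ _ f => fmap G (fmap F f))
    (functor_comp_id G F) (functor_comp_comp G F).

Record natural_iso (C D : category) (F G : functor C D) := NaturalIso {
  niso : forall A : C, hom (F A) (G A);
  niso_inv : forall A : C, hom (G A) (F A);
  nisoK : forall A, comp (niso_inv A) (niso A) = idm (F A);
  niso_invK : forall A, comp (niso A) (niso_inv A) = idm (G A);
  niso_natural : forall (A B : C) (f : hom A B),
    comp (niso B) (fmap F f) = comp (fmap G f) (niso A)
}.

Definition equivalent_categories (C D : category) : Prop :=
  exists (F : functor C D) (G : functor D C),
    inhabited (natural_iso (functor_comp G F) (functor_id C)) /\
    inhabited (natural_iso (functor_comp F G) (functor_id D)).

(** * Strict omega-categories *)

Variant sign := minus | plus.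

(** A single-sorted small category on [T]: [d minus] and [d plus] give the left
    and right identities, and the partial composition [c x y], written in
    diagrammatic order, is [None] where it is undefined. *)
Record is_cat (T : Type) (d : sign -> T -> T) (c : T -> T -> option T) : Prop :=
  IsCat {
  cat_defined : forall x y, isSome (c x y) <-> d plus x = d minus y;
  cat_d_d : forall a b x, d a (d b x) = d b x;
  cat_source : forall x y z, c x y = Some z -> d minus z = d minus x;
  cat_target : forall x y z, c x y = Some z -> d plus z = d plus y;
  cat_idl : forall x, c (d minus x) x = Some x;
  cat_idr : forall x, c x (d plus x) = Some x;
  cat_assoc : forall x y z u v,
    c x y = Some u -> c y z = Some v -> c u z = c x v
}.

Record is_cat_morphism (T U : Type)
    (d : sign -> T -> T) (c : T -> T -> option T)
    (d' : sign -> U -> U) (c' : U -> U -> option U) (f : T -> U) : Prop :=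
  IsCatMorphism {
  cat_morphism_d : forall a x, f (d a x) = d' a (f x);
  cat_morphism_c : forall x y z, c x y = Some z -> c' (f x) (f y) = Some (f z)
}.

Record omega_cat := OmegaCat {
  cell :> Type;
  oid : nat -> sign -> cell -> cell;
  ocomp : nat -> cell -> cell -> option cell;
  omega_is_cat : forall n, is_cat (oid n) (ocomp n);
  omega_d_functorial : forall m n a, m <> n ->
    is_cat_morphism (oid n) (ocomp n) (oid n) (ocomp n) (oid m a);
  (* Together with the previous axiom, this says that [ocomp m] is functorial
     for the [n]-structure. *)
  omega_interchange : forall m n x y z w s t u v, m <> n ->
    ocomp m x y = Some s -> ocomp m z w = Some t ->
    ocomp n x z = Some u -> ocomp n y w = Some v ->
    ocomp n s t = ocomp m u v;
  omega_globular : forall m n a b x, (m < n)%N ->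
    oid m b (oid n a x) = oid m b x /\ oid n a (oid m b x) = oid m b x;
  omega_finite_dim : forall x, exists m, forall a, oid m a x = x
}.

Record omega_functor (C D : omega_cat) := OmegaFunctor {
  omega_fun :> C -> D;
  omega_funP : forall n,
    is_cat_morphism (@oid C n) (@ocomp C n) (@oid D n) (@ocomp D n) omega_fun
}.

Lemma omega_functor_eq (C D : omega_cat) (F G : omega_functor C D) :
  omega_fun F = omega_fun G -> F = G.
Proof.
by case: F G => [f Hf] [g Hg] /= efg; case: _ / efg Hg => Hg;
  congr OmegaFunctor; exact: Prop_irrelevance.
Qed.

Lemma omega_id_subproof (C : omega_cat) n :
  is_cat_morphism (@oid C n) (@ocomp C n) (@oid C n) (@ocomp C n) id.
Proof. by split. Qed.

Definition omega_id (C : omega_cat) : omega_functor C C :=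
  OmegaFunctor (@omega_id_subproof C).

Lemma omega_comp_subproof (C D E : omega_cat)
  (G : omega_functor D E) (F : omega_functor C D) n :
  is_cat_morphism (@oid C n) (@ocomp C n) (@oid E n) (@ocomp E n)
    (fun x => G (F x)).
Proof.
have [Fd Fc] := omega_funP F n; have [Gd Gc] := omega_funP G n.
by split=> [a x|x y z /Fc /Gc]; rewrite ?Fd ?Gd.
Qed.

Definition omega_comp (C D E : omega_cat)
    (G : omega_functor D E) (F : omega_functor C D) : omega_functor C E :=
  OmegaFunctor (omega_comp_subproof G F).

Definition omega_categories : category.
Proof.
apply: (@Category omega_cat omega_functor omega_id omega_comp).
- by move=> A B f; exact: omega_functor_eq.
- by move=> A B f; exact: omega_functor_eq.
- by move=> A B C D h g f; exact: omega_functor_eq.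
Defined.

(** * Globular sets and simple omega-categories *)

(** [bd] is total for convenience: its values on 0-dimensional elements are
    unconstrained and never used. *)
Record globular_set := GlobularSet {
  gelt :> Type;
  gdim : gelt -> nat;
  bd : sign -> gelt -> gelt;
  gdim_bd : forall a x, (0 < gdim x)%N -> gdim (bd a x) = (gdim x).-1;
  bd_bd : forall a x, (2 <= gdim x)%N -> bd a (bd minus x) = bd a (bd plus x)
}.

Variant gstep (G : globular_set) : G -> G -> Prop :=
| Gstep_minus x : (0 < gdim x)%N -> gstep (bd minus x) x
| Gstep_plus x : (0 < gdim x)%N -> gstep x (bd plus x).

Definition strict_total_order (T : Type) (R : T -> T -> Prop) : Prop :=
  [/\ forall x, ~ R x x,
      forall x y z, R x y -> R y z -> R x z
    & forall x y, [\/ R x y, x = y | R y x]].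

Definition simple_globular_set (G : globular_set) : Prop :=
  [/\ inhabited G, finite_set [set: G]%classic
    & strict_total_order (clos_trans G (@gstep G))].

(** The defining relations of the presentation of a free omega-category. *)
Definition free_relations (G : globular_set) (C : omega_cat) (f : G -> C) :
  Prop :=
  (forall a x, oid (gdim x) a (f x) = f x) /\
  (forall a x, (0 < gdim x)%N -> oid (gdim x).-1 a (f x) = f (bd a x)).

(** [C] is presented by the generators [G] and the relations above. *)
Definition is_free_omega_cat (G : globular_set) (C : omega_cat) : Prop :=
  exists i : G -> C, free_relations i /\
    forall (D : omega_cat) (f : G -> D), free_relations f ->
      exists! F : omega_functor C D, forall x, F (i x) = f x.

Definition simple_omega_cat (C : omega_cat) : Prop :=
  exists G : globular_set, simple_globular_set G /\ is_free_omega_cat G C.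

Definition Theta : category :=
  @full_subcategory omega_categories simple_omega_cat.

(** * Coaugmented cochain complexes with prescribed bases *)

Record coaug_complex := CoaugComplex {
  cochain :> nat -> zmodType;
  cobd : forall n, {additive cochain n -> cochain n.+1};
  coaug : {additive int -> cochain 0%N};
  cobd_cobd : forall n x, cobd n.+1 (cobd n x) = 0;
  cobd_coaug : forall k, cobd 0%N (coaug k) = 0
}.

Section PrescribedBases.

Variables (p : nat) (dim : 'I_p.+1 -> nat).

(** Indices of the [n]-dimensional members of a graded basis [c_0, ..., c_p]
    whose member [c_q] has dimension [dim q]. *)
Definition bindex (n : nat) := {q : 'I_p.+1 | dim q == n}.

Definition is_graded_basis (C : nat -> zmodType)
    (c : forall n, bindex n -> C n) : Prop :=
  forall n (x : C n), exists! a : {ffun bindex n -> int},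
    x = \sum_q c n q *~ a q.

(** [in_delta_plus q r]: given [dim r = (dim q).+1], the element [c_r] occurs in
    the sum defining [delta^+ c_q]; similarly for [in_delta_minus]. *)
Definition in_delta_plus (q r : 'I_p.+1) : bool :=
  (r < q)%N && [forall t : 'I_p.+1, (r <= t < q)%N ==> (dim q < dim t)%N].

Definition in_delta_minus (q s : 'I_p.+1) : bool :=
  (q < s)%N && [forall t : 'I_p.+1, (q < t <= s)%N ==> (dim q < dim t)%N].

End PrescribedBases.

Record disc_complex := DiscComplex {
  dcomplex :> coaug_complex;
  dlast : nat;
  ddim : 'I_dlast.+1 -> nat;
  dbasis : forall n, bindex ddim n -> dcomplex n;
  dbasisP : is_graded_basis dbasis;
  ddim_first : ddim ord0 = 0%N;
  ddim_last : ddim ord_max = 0%N;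
  ddim_step : forall q r : 'I_dlast.+1, r = q.+1 :> nat ->
    ddim r = (ddim q).+1 \/ ddim q = (ddim r).+1;
  dcoaugE : coaug dcomplex 1 = \sum_q dbasis (n := 0%N) q;
  dcobdE : forall n (q : bindex ddim n),
    cobd dcomplex n (dbasis q) =
      \sum_(r : bindex ddim n.+1 | in_delta_plus ddim (val q) (val r)) dbasis r
      - \sum_(s : bindex ddim n.+1 | in_delta_minus ddim (val q) (val s)) dbasis s
}.

Definition is_basis_sum (C : disc_complex) (n : nat) (x : C n) : Prop :=
  exists s : seq (bindex (@ddim C) n), x = \sum_(q <- s) dbasis q.

Record disc_map (C D : disc_complex) := DiscMap {
  dmap :> forall n, {additive C n -> D n};
  dmap_cobd : forall n x, dmap n.+1 (cobd C n x) = cobd D n (dmap n x);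
  dmap_coaug : forall k, dmap 0%N (coaug C k) = coaug D k;
  dmap_sum : forall n x, is_basis_sum x -> is_basis_sum (dmap n x)
}.

Lemma additive_eq (U V : zmodType) (f g : {additive U -> V}) : f =1 g -> f = g.
Proof.
case: f g => [f [[Hf]]] [g [[Hg]]] /= /funext efg.
by case: _ / efg Hg => Hg; rewrite (Prop_irrelevance Hf Hg).
Qed.

Lemma disc_map_eq (C D : disc_complex) (f g : disc_map C D) :
  (forall n x, f n x = g n x) -> f = g.
Proof.
case: f g => [f f1 f2 f3] [g g1 g2 g3] /= efg.
have {}efg : f = g by apply: functional_extensionality_dep => n;
  apply: additive_eq => x; exact: efg.
by case: _ / efg g1 g2 g3 => g1 g2 g3; congr DiscMap; exact: Prop_irrelevance.
Qed.

Definition disc_id (C : disc_complex) : disc_map C C :=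
  @DiscMap C C (fun n => idfun) (fun _ _ => erefl) (fun _ => erefl)
    (fun _ _ h => h).

Definition disc_comp (C D E : disc_complex)
  (g : disc_map D E) (f : disc_map C D) : disc_map C E.
Proof.
apply: (@DiscMap C E (fun n => g n \o f n)).
- by move=> n x /=; rewrite !dmap_cobd.
- by move=> k /=; rewrite !dmap_coaug.
- by move=> n x /= /(dmap_sum f) /(dmap_sum g).
Defined.

Definition disc_complexes : category.
Proof.
apply: (@Category disc_complex disc_map disc_id disc_comp).
- by move=> A B f; exact: disc_map_eq.
- by move=> A B f; exact: disc_map_eq.
- by move=> A B C D h g f; exact: disc_map_eq.
Defined.

(* Main.v *)
From HB Require Import structures.
From Stdlib Require Import Relations.
From mathcomp Require Import all_boot all_order all_algebra.
From mathcomp Require Import boolp classical_sets functions cardinality.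
From mathcomp Require Import zify.
Require Import Defs.

(** Both categories are governed by the same combinatorial datum: a zigzag of
    dimensions c_0, ..., c_p. It is the graded basis of a disc complex, and it is
    a simple globular set in which the source of c_r is the last earlier element
    of dimension one less and the target the first such later element. The
    coboundary of the disc complex is dual to the boundary, target minus source,
    of this globular set.

    Following Steiner, a zigzag z has an omega-category [zcells z] of pairs of
    sequences x^-, x^+ of nonnegative chains for which the boundary of each
    x_(n+1)^s is x_n^+ - x_n^- and x_0^s has augmentation 1. Composition is
    x + y - d_n^+ x, so the axioms are linear algebra ([cells]). The central fact
    is that [zcells z] is free on the globular set of z ([zcells_free]). Granted
    this, an omega-functor from [zcells z] to [zcells w] is a family of cells of
    w that satisfies the free relations, which amounts to a matrix of natural
    numbers commuting with boundary and augmentation ([functor_matrix]);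
    transposed, this is precisely a map of disc complexes taking basis sums to
    basis sums ([disc_mx_chain], [mx_map]). This yields a fully faithful functor
    from disc complexes to the opposite of Theta. It is essentially surjective
    because every simple globular set comes from a zigzag ([simple_zigzag]) and
    free omega-categories are unique up to isomorphism ([free_unique]).

    Freeness is proved by induction over arches, intervals of the zigzag between
    two elements of equal dimension that never go below this dimension
    ([arch_ind]). The cells supported by a one-element arch are the atoms of a
    globe ([globe_atom]). If an arch of dimension n has an interior element m of
    dimension n, two retractions of the chain complex, the clamps, show that a
    cell which is not supported on one side of m is the composite over m of its
    left and right parts ([clamp_split]), so that omega-functors defined on the
    two sides glue ([extends_split]). Two properties control cells: up to
    dimension n their chains are zero or a single basis element ([mass_bool]),
    and positivity together with the linear order excludes nonzero closed chains
    ([flow], [no_loop]). *)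

Set Implicit Arguments.
Unset Strict Implicit.
Unset Printing Implicit Defensive.

Import GRing.Theory.

(** * Equivalences from fully faithful, essentially surjective functors *)

Lemma equivalence_of_fully_faithful (C D : category) (F : functor D C) :
  (forall A B (f g : hom A B), fmap F f = fmap F g -> f = g) ->
  (forall A B (h : hom (F A) (F B)), exists f : hom A B, fmap F f = h) ->
  (forall X : C, exists (A : D) (u : hom (F A) X) (v : hom X (F A)),
    comp v u = idm (F A) /\ comp u v = idm X) ->
  equivalent_categories C D.
Proof.
move=> faith full esurj.
pose G0 X := sval (cid (esurj X)).
pose u X : hom (F (G0 X)) X := sval (cid (svalP (cid (esurj X)))).
pose v X : hom X (F (G0 X)) := sval (cid (svalP (cid (svalP (cid (esurj X)))))).
have [vu uv] : (forall X, comp (v X) (u X) = idm _)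
    /\ (forall X, comp (u X) (v X) = idm _).
  by split=> X; have [] := svalP (cid (svalP (cid (svalP (cid (esurj X)))))).
pose lft A B (h : hom (F A) (F B)) := sval (cid (full A B h)).
have lftK A B h : fmap F (@lft A B h) = h := svalP (cid (full A B h)).
pose G1 X Y (h : hom X Y) := lft _ _ (comp (v Y) (comp h (u X))).
have G1_id X : G1 X X (idm X) = idm (G0 X).
  by apply: faith; rewrite lftK comp1m vu fmap1.
have G1_comp X Y Z (h : hom Y Z) (k : hom X Y) :
    G1 X Z (comp h k) = comp (G1 Y Z h) (G1 X Y k).
  apply: faith; rewrite fmapD !lftK !compmA -(compmA _ (u Y)).
  by rewrite uv compm1.
pose G : functor C D := Functor G1_id G1_comp.
exists G, F; split; split.
  apply: (@NaturalIso C C (functor_comp F G) (functor_id C) u v) => // X Y h.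
  by rewrite /= lftK !compmA uv comp1m.
apply: (@NaturalIso D D (functor_comp G F) (functor_id D)
  (fun A => lft _ _ (u (F A))) (fun A => lft _ _ (v (F A)))) => [A|A|A B f].
- by apply: faith; rewrite fmapD !lftK vu fmap1.
- by apply: faith; rewrite fmapD !lftK uv fmap1.
- by apply: faith; rewrite /= !fmapD !lftK !compmA uv comp1m.
Qed.

(** * The omega-category of cells of a finite incidence system *)

(** The basis of a chain complex of free abelian groups in which the boundary
    of [g] is the sum of its [plus]-faces minus the sum of its [minus]-faces;
    [iface s q g] says that [q] is an [s]-face of [g]. *)
Record incidence := Incidence {
  isort :> finType;
  idim : isort -> nat;
  iface : sign -> rel isort;
  iface_dim : forall s q g, iface s q g -> idim g = (idim q).+1
}.

Section Cells.

Variable I : incidence.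
Local Notation dim := (@idim I).
Local Notation face := (@iface I).
Implicit Types (x y z : sign -> I -> nat).

(** A cell in the sense of Steiner: nonnegative chains x_n^-, x_n^+ of dimension
    n, with augmentation 1 for n = 0, such that the boundary of x_(n+1)^s is
    x_n^+ - x_n^- for both signs s. As basis elements carry their dimension, the
    chains of one sign form a single function. The second clause is the
    coefficient of the boundary equation at [q], with negative terms moved to
    the other side so that it lives in [nat]. *)
Definition is_cell x : Prop :=
  (forall s, \sum_(q | dim q == 0) x s q = 1) /\
  (forall s q, \sum_(g | face plus q g) x s g + x minus q =
               \sum_(g | face minus q g) x s g + x plus q).

Definition trunc n a x : sign -> I -> nat := fun s q =>
  if dim q < n then x s q else if dim q == n then x a q else 0.

(** The sum x + y - d_n^+ x, which for composable x and y takes this form in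
    each dimension. *)
Definition paste n x y : sign -> I -> nat := fun s q =>
  if dim q < n then x s q else
  if dim q == n then (if s is plus then y plus q else x minus q)
  else x s q + y s q.

Definition composable n x y : Prop := trunc n plus x = trunc n minus y.

Lemma chain_eq x y : (forall s q, x s q = y s q) -> x = y.
Proof. by move=> exy; apply/funext => s; apply/funext. Qed.

Lemma composableP n x y : composable n x y <->
  (forall s q, dim q < n -> x s q = y s q) /\
  (forall q, dim q = n -> x plus q = y minus q).
Proof.
rewrite /composable; split=> [exy | [lo eqn]].
  have e s q : trunc n plus x s q = trunc n minus y s q by rewrite exy.
  split=> [s q qn | q qn]; first by move: (e s q); rewrite /trunc qn.
  by move: (e plus q); rewrite /trunc qn ltnn eqxx.
apply: chain_eq => s q; rewrite /trunc.
by case: ltngtP => // qn; [exact: lo | exact: eqn].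
Qed.

Lemma sum_face_trunc n a x s b q :
  \sum_(g | face b q g) trunc n a x s g =
  if (dim q).+1 < n then \sum_(g | face b q g) x s g else
  if (dim q).+1 == n then \sum_(g | face b q g) x a g else 0.
Proof.
rewrite /trunc.
case: ltngtP => qn.
- by apply: eq_bigr => g /iface_dim ->; rewrite qn.
- by apply: big1 => g /iface_dim ->; rewrite ltnNge (ltnW qn) gtn_eqF.
- by apply: eq_bigr => g /iface_dim ->; rewrite qn ltnn eqxx.
Qed.

Lemma trunc_cell n a x : is_cell x -> is_cell (trunc n a x).
Proof.
move=> [x0 xb]; split=> [s|s q].
  case: n => [|n].
    by rewrite -(x0 a); apply: eq_bigr => q /eqP q0; rewrite /trunc q0.
  by rewrite -(x0 s); apply: eq_bigr => q /eqP q0; rewrite /trunc q0.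
rewrite !sum_face_trunc; move: (xb s q) (xb a q) => xs xa.
rewrite /trunc; case: (ltngtP (dim q).+1 n) => qn;
  case: (ltngtP (dim q) n) => qn'; lia.
Qed.

Lemma paste_cell n x y :
  is_cell x -> is_cell y -> composable n x y -> is_cell (paste n x y).
Proof.
move=> [x0 xb] [y0 yb] /composableP[lo eqn]; split=> [s|s q].
  case: n lo eqn => [|n] lo eqn; last first.
    by rewrite -(x0 s); apply: eq_bigr => q /eqP q0; rewrite /paste q0.
  case: s; [rewrite -(x0 minus) | rewrite -(y0 plus)];
    by apply: eq_bigr => q /eqP q0; rewrite /paste q0.
have sumE b : \sum_(g | face b q g) paste n x y s g =
  if (dim q).+1 < n then \sum_(g | face b q g) x s g else
  if (dim q).+1 == n then (if s is plus then \sum_(g | face b q g) y plus g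
     else \sum_(g | face b q g) x minus g)
  else \sum_(g | face b q g) x s g + \sum_(g | face b q g) y s g.
  rewrite /paste; case: ltngtP => qn.
  - by apply: eq_bigr => g /iface_dim ->; rewrite qn.
  - rewrite -big_split; apply: eq_bigr => g /iface_dim ->.
    by rewrite ltnNge (ltnW qn) gtn_eqF.
  - case: s; by apply: eq_bigr => g /iface_dim ->; rewrite qn ltnn eqxx.
rewrite !sumE /paste; move: (xb s q) (yb s q) => xs ys.
case: (ltngtP (dim q).+1 n) => qn;
  case: (ltngtP (dim q) n) => qn'; try lia.
- by have := eqn q qn'; lia.
- by case: s xs ys {sumE} => xs ys; have := lo minus q qn';
    have := lo plus q qn'; lia.
Qed.

Definition cell_type := {x : sign -> I -> nat | is_cell x}.

Lemma cell_type_eq (x y : cell_type) : sval x = sval y -> x = y.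
Proof.
case: x y => [x Hx] [y Hy] /= e; case: _ / e Hy => Hy.
by congr exist; exact: Prop_irrelevance.
Qed.

Definition cell_id n a (x : cell_type) : cell_type :=
  exist _ (trunc n a (sval x)) (trunc_cell n a (svalP x)).

Definition cell_comp n (x y : cell_type) : option cell_type :=
  if pselect (composable n (sval x) (sval y)) is left xy
  then Some (exist _ _ (paste_cell (svalP x) (svalP y) xy)) else None.

Lemma cell_compP n (x y z : cell_type) : cell_comp n x y = Some z <->
  composable n (sval x) (sval y) /\ paste n (sval x) (sval y) = sval z.
Proof.
rewrite /cell_comp; case: pselect => [xy|nxy]; last by split=> // -[].
split=> [[<-]//|[_ e]]; congr Some; exact: cell_type_eq.
Qed.

Lemma cell_comp_eq n m (x y z w : cell_type) :
  composable n (sval x) (sval y) -> composable m (sval z) (sval w) ->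
  paste n (sval x) (sval y) = paste m (sval z) (sval w) ->
  cell_comp n x y = cell_comp m z w.
Proof.
move=> xy zw e; have zwE := paste_cell (svalP z) (svalP w) zw.
transitivity (Some (exist _ _ zwE : cell_type)); last apply: esym;
  by apply/cell_compP.
Qed.

Lemma trunc_trunc m n a b x : trunc m a (trunc n b x) =
  if m < n then trunc m a x else trunc n b x.
Proof.
apply: chain_eq => s q; rewrite /trunc.
by case: (ltngtP m n) => mn; case: (ltngtP (dim q) m) => qm;
  case: (ltngtP (dim q) n) => qn //; lia.
Qed.

Lemma trunc_paste m n a x y : composable n x y -> trunc m a (paste n x y) =
  if m < n then trunc m a x else
  if m == n then (if a is plus then trunc m a y else trunc m a x)
  else paste n (trunc m a x) (trunc m a y).
Proof.
move=> /composableP[lo eqn]; apply: chain_eq => s q; rewrite /trunc /paste.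
case: (ltngtP m n) => mn; case: a; case: s;
case: (ltngtP (dim q) m) => qm;
  case: (ltngtP (dim q) n) => qn //; rewrite ?lo //; lia.
Qed.

Lemma composable_trunc m n a x y : m <> n -> composable n x y ->
  composable n (trunc m a x) (trunc m a y).
Proof.
move=> /eqP mn xy; have := xy; rewrite /composable !trunc_trunc => e.
have [lt_mn|gt_mn|] := ltngtP m n; last by move/eqP: mn.
  have /(congr1 (trunc m a)) := xy.
  by rewrite !trunc_trunc lt_mn.
by [].
Qed.

Lemma paste_idl n x : paste n (trunc n minus x) x = x.
Proof.
apply: chain_eq => s q; rewrite /paste /trunc.
by case: ltngtP => qn //; case: s.
Qed.

Lemma paste_idr n x : paste n x (trunc n plus x) = x.
Proof.
apply: chain_eq => s q; rewrite /paste /trunc.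
by case: ltngtP => qn //; rewrite ?addn0 //; case: s.
Qed.

Lemma pasteA n x y z : paste n (paste n x y) z = paste n x (paste n y z).
Proof.
apply: chain_eq => s q; rewrite /paste.
by case: ltngtP => qn //; rewrite ?addnA //; case: s.
Qed.

Lemma paste_interchange m n x y z w : m <> n ->
  composable m x y -> composable m z w -> composable n x z -> composable n y w ->
  composable n (paste m x y) (paste m z w) /\
  paste n (paste m x y) (paste m z w) = paste m (paste n x z) (paste n y w).
Proof.
move=> mn /composableP[xy1 xy2] /composableP[zw1 zw2].
move=> /composableP[xz1 xz2] /composableP[yw1 yw2]; split.
  apply/composableP; split=> [s q qn|q qn]; rewrite /paste.
    by case: (ltngtP (dim q) m) => qm; case: s; rewrite ?xz1 ?yw1.
  by case: (ltngtP (dim q) m) => qm //; rewrite ?xz2 ?yw2 //; lia.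
apply: chain_eq => s q; rewrite /paste.
case: (ltngtP (dim q) m) => qm; case: (ltngtP (dim q) n) => qn //; try lia.
  by case: s; rewrite // ?xy1 ?zw1.
by case: s; rewrite // xz1 // yw1.
Qed.

Lemma cell_is_cat n : is_cat (cell_id n) (cell_comp n).
Proof.
split.
- move=> x y; rewrite /cell_comp; case: pselect => xy; split=> // e.
    exact: cell_type_eq.
  by case: xy; have := congr1 sval e.
- by move=> a b x; apply: cell_type_eq; rewrite /= trunc_trunc ltnn.
- move=> x y z /cell_compP[xy e]; apply: cell_type_eq.
  by rewrite /= -e trunc_paste // ltnn eqxx.
- move=> x y z /cell_compP[xy e]; apply: cell_type_eq.
  by rewrite /= -e trunc_paste // ltnn eqxx.
- move=> x; apply/cell_compP; split; last exact: paste_idl.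
  by rewrite /composable /= trunc_trunc ltnn.
- move=> x; apply/cell_compP; split; last exact: paste_idr.
  by rewrite /composable /= trunc_trunc ltnn.
- move=> x y z u v /cell_compP[xy eu] /cell_compP[yz ev].
  apply: cell_comp_eq; rewrite -?eu -?ev ?pasteA //; rewrite /composable.
    by rewrite trunc_paste // ltnn eqxx.
  by rewrite trunc_paste // ltnn eqxx.
Qed.

Lemma cell_d_functorial m n a : m <> n -> is_cat_morphism
  (cell_id n) (cell_comp n) (cell_id n) (cell_comp n) (cell_id m a).
Proof.
move=> mn; split=> [b x|x y z /cell_compP[xy e]].
  apply: cell_type_eq; rewrite /= !trunc_trunc.
  by case: ltngtP mn.
apply/cell_compP; split; first exact: composable_trunc.
rewrite /= -e trunc_paste //; case: (ltngtP m n) (mn) => // lt_mn _.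
have := xy; rewrite /composable => /(congr1 (trunc m a)).
rewrite !trunc_trunc lt_mn => <-.
have := paste_idr n (trunc m a (sval x)).
by rewrite trunc_trunc ltnNge ltnW.
Qed.

Lemma cell_interchange m n (x y z w s t u v : cell_type) : m <> n ->
  cell_comp m x y = Some s -> cell_comp m z w = Some t ->
  cell_comp n x z = Some u -> cell_comp n y w = Some v ->
  cell_comp n s t = cell_comp m u v.
Proof.
move=> mn /cell_compP[xy es] /cell_compP[zw et] /cell_compP[xz eu].
move=> /cell_compP[yw ev].
have [st e] := paste_interchange mn xy zw xz yw.
have [uv _] := paste_interchange (not_eq_sym mn) xz yw xy zw.
by apply: cell_comp_eq; rewrite -?es -?et -?eu -?ev.
Qed.

Lemma cell_globular m n a b (x : cell_type) : m < n ->
  cell_id m b (cell_id n a x) = cell_id m b x /\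
  cell_id n a (cell_id m b x) = cell_id m b x.
Proof.
move=> mn; split; apply: cell_type_eq; rewrite /= trunc_trunc.
  by rewrite mn.
by rewrite ltnNge ltnW.
Qed.

Lemma cell_finite_dim (x : cell_type) : exists m, forall a, cell_id m a x = x.
Proof.
exists (\max_(q : I) dim q).+1 => a; apply: cell_type_eq.
apply: chain_eq => s q; rewrite /= /trunc ltnS.
by rewrite (leq_bigmax (F := fun q : I => dim q)).
Qed.

Definition cells : omega_cat :=
  OmegaCat cell_is_cat cell_d_functorial cell_interchange cell_globular
    cell_finite_dim.

End Cells.

Arguments is_cell {I} x.

(** * Chain maps given by matrices of natural numbers *)

Section Push.

Variables I J : incidence.
Implicit Types (M : I -> J -> nat) (x : sign -> I -> nat).

Definition push M x : sign -> J -> nat :=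
  fun s q => \sum_g x s g * M g q.

Definition graded_matrix M : Prop :=
  forall g q, idim g <> idim q -> M g q = 0.

(** The image of [g] under [M] has the augmentation of [g], and its boundary is
    the image of the boundary of [g], again with negative terms moved across.
    The condition is local in [g] because the clamps used below are chain maps
    only on the part of the complex that supports a given cell. *)
Definition chain_at M (g : I) : Prop :=
  (idim g = 0 -> \sum_(q | idim q == 0) M g q = 1) /\
  forall q,
  \sum_(q' | iface plus q q') M g q' + \sum_(h | iface minus h g) M h q =
  \sum_(q' | iface minus q q') M g q' + \sum_(h | iface plus h g) M h q.

(** In every other degree both sides of the boundary identity vanish. *)
Lemma chain_at_graded M g : graded_matrix M ->
  (idim g = 0 -> \sum_(q | idim q == 0) M g q = 1) ->
  (forall q, idim g = (idim q).+1 ->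
    \sum_(q' | iface plus q q') M g q' + \sum_(h | iface minus h g) M h q =
    \sum_(q' | iface minus q q') M g q' + \sum_(h | iface plus h g) M h q) ->
  chain_at M g.
Proof.
move=> Mgr aug bdry; split=> // q.
have [/bdry //|gq] := eqVneq (idim g) (idim q).+1.
have A b : \sum_(q' | iface b q q') M g q' = 0.
  apply: big1 => q' /iface_dim q'q; apply: Mgr => e.
  by move: gq; rewrite e q'q eqxx.
have B b : \sum_(h | iface b h g) M h q = 0.
  apply: big1 => h /iface_dim hg; apply: Mgr => e.
  by move: gq; rewrite hg e eqxx.
by rewrite !A !B.
Qed.

Lemma sum_pos_neq0 (T : finType) (P : pred T) (F : T -> nat) :
  \sum_(i | P i) F i <> 0 -> exists2 i, P i & F i <> 0.
Proof.
move=> nz; apply: contrapT => no; apply: nz; apply: big1 => i Pi.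
by apply: contrapT => Fi; apply: no; exists i.
Qed.

Lemma push_cell M x : graded_matrix M ->
  (forall s g, x s g <> 0 -> chain_at M g) -> is_cell x -> is_cell (push M x).
Proof.
move=> Mgr Mch [x0 xb]; split=> [s|s q]; rewrite /push.
  rewrite exchange_big /= -[RHS](x0 s) [RHS]big_mkcond; apply: eq_bigr => g _.
  rewrite -big_distrr /=; case: ifP => g0.
    have [->|/eqP /Mch[/(_ (eqP g0)) -> _]] := eqVneq (x s g) 0 => //.
    by rewrite muln1.
  rewrite big1 ?muln0 // => q /eqP q0; apply: Mgr; rewrite q0.
  by move/eqP: g0.
have swapA b : \sum_(q' | iface b q q') \sum_g x s g * M g q' =
    \sum_g x s g * \sum_(q' | iface b q q') M g q'.
  by rewrite exchange_big; apply: eq_bigr => g _; rewrite big_distrr.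
have swapB b : \sum_g x s g * \sum_(h | iface b h g) M h q =
    \sum_h M h q * \sum_(g | iface b h g) x s g.
  under eq_bigr do rewrite big_distrr /= big_mkcond /=.
  rewrite exchange_big; apply: eq_bigr => h _.
  by rewrite big_distrr -big_mkcond /=; apply: eq_bigr => g _; rewrite mulnC.
rewrite !swapA.
have e1 : \sum_g x s g * \sum_(q' | iface plus q q') M g q' +
          \sum_g x s g * \sum_(h | iface minus h g) M h q =
          \sum_g x s g * \sum_(q' | iface minus q q') M g q' +
          \sum_g x s g * \sum_(h | iface plus h g) M h q.
  rewrite -!big_split; apply: eq_bigr => g _ /=; rewrite -!mulnDr.
  by have [->//|/eqP /Mch[_ ->]] := eqVneq (x s g) 0.
have e2 : \sum_h M h q * \sum_(g | iface plus h g) x s g +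
          \sum_h x minus h * M h q =
          \sum_h M h q * \sum_(g | iface minus h g) x s g +
          \sum_h x plus h * M h q.
  rewrite -!big_split; apply: eq_bigr => h _ /=.
  by rewrite [x _ _ * _]mulnC [x plus _ * _]mulnC -!mulnDr xb.
move: e1 e2; rewrite !swapB; lia.
Qed.

Lemma push_trunc M x n a : graded_matrix M ->
  push M (trunc n a x) = trunc n a (push M x).
Proof.
move=> Mgr; apply: chain_eq => s q; rewrite /push /trunc.
have Mz g : idim g != idim q -> M g q = 0 by move=> /eqP /Mgr.
have cong u v : (forall g, idim g = idim q -> u g = v g) ->
   \sum_g u g * M g q = \sum_g v g * M g q.
  move=> e; apply: eq_bigr => g _.
  by have [/e ->//|/Mz ->] := eqVneq (idim g) (idim q); rewrite !muln0.
case: ltngtP => qn.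
- by apply: cong => g ->; rewrite qn.
- rewrite (cong _ (fun=> 0)) ?big1 // => g ->.
  by rewrite ltnNge (ltnW qn) gtn_eqF.
- by apply: cong => g ->; rewrite qn ltnn eqxx.
Qed.

Lemma push_paste M x y n : graded_matrix M ->
  push M (paste n x y) = paste n (push M x) (push M y).
Proof.
move=> Mgr; apply: chain_eq => s q; rewrite /push /paste.
have Mz g : idim g != idim q -> M g q = 0 by move=> /eqP /Mgr.
have cong u v : (forall g, idim g = idim q -> u g = v g) ->
   \sum_g u g * M g q = \sum_g v g * M g q.
  move=> e; apply: eq_bigr => g _.
  by have [/e ->//|/Mz ->] := eqVneq (idim g) (idim q); rewrite !muln0.
case: ltngtP => qn.
- by apply: cong => g ->; rewrite qn.
- rewrite -big_split /=.
  rewrite (cong _ (fun g => x s g + y s g)); last first.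
    by move=> g ->; rewrite ltnNge (ltnW qn) gtn_eqF.
  by apply: eq_bigr => g _; rewrite mulnDl.
- by case: s; apply: cong => g ->; rewrite qn ltnn eqxx.
Qed.

Lemma push_composable M x y n : graded_matrix M ->
  composable n x y -> composable n (push M x) (push M y).
Proof. by move=> Mgr xy; rewrite /composable -!push_trunc // xy. Qed.

Definition chain_matrix M : Prop := graded_matrix M /\ forall g, chain_at M g.

Definition push_fun M (chM : chain_matrix M) (x : cells I) : cells J :=
  exist _ (push M (sval x)) (push_cell chM.1 (fun _ g _ => chM.2 g) (svalP x)).

Lemma push_funP M (chM : chain_matrix M) n : is_cat_morphism
  (@oid (cells I) n) (@ocomp (cells I) n)
  (@oid (cells J) n) (@ocomp (cells J) n) (push_fun chM).
Proof.
split=> [a x|x y z /cell_compP[xy e]].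
  by apply: cell_type_eq; exact: push_trunc chM.1.
apply/cell_compP; split; first exact: push_composable chM.1 _.
by rewrite /= -e push_paste //; exact: chM.1.
Qed.

Definition push_functor M (chM : chain_matrix M) : omega_functor (cells I) (cells J) :=
  OmegaFunctor (push_funP chM).

End Push.

(** * Zigzags of dimensions *)

(** The dimensions of c_0, ..., c_p. A zigzag determines a totally ordered
    globular set, in which the source of an element is the last earlier one of
    dimension one less and the target is the first such later one. *)
Record zigzag := Zigzag {
  zlast : nat;
  zdim : 'I_zlast.+1 -> nat;
  zdim_first : zdim ord0 = 0;
  zdim_last : zdim ord_max = 0;
  zdim_step : forall q r : 'I_zlast.+1, r = q.+1 :> nat ->
    zdim r = (zdim q).+1 \/ zdim q = (zdim r).+1
}.

Section Zigzag.

Variable z : zigzag.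
Local Notation I := 'I_(zlast z).+1.
Local Notation dim := (@zdim z).
Implicit Types (q r g t u v : I) (s a b : sign).

(** For arbitrary dimensions, [bnd s q g] says that [q] is the iterated [s]-face
    of [g] in the dimension of [q]. *)
Definition bnd s q g : bool :=
  if s is minus then in_delta_minus dim q g else in_delta_plus dim q g.

Definition side s q g : bool := if s is minus then q < g else g < q.

Definition betw u v t : Prop := minn u v <= t <= maxn u v.

Lemma bndP s q g : bnd s q g <->
  side s q g /\ forall t, t <> q -> betw q g t -> dim q < dim t.
Proof.
have nq t : (t <> q) <-> (t <> q :> nat).
  by split=> [tq e|tq e]; apply: tq; [apply: val_inj|rewrite e].
split.
  case: s => /= /andP[qg /forallP h]; split=> // t /nq tq tb;
    by apply: (implyP (h t)); move: tb; rewrite /betw; lia.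
case=> qg h; case: s qg => /= qg; apply/andP; split=> //; apply/forallP => t;
  apply/implyP => tb; apply: h; rewrite ?nq /betw; lia.
Qed.

Lemma bnd_side s q g : bnd s q g -> side s q g.
Proof. by case/bndP. Qed.

Lemma bnd_dim s q g : bnd s q g -> dim q < dim g.
Proof.
case/bndP => sqg; apply; last by rewrite /betw; lia.
by move=> e; move: sqg; rewrite e; case: s => /=; rewrite ltnn.
Qed.

(** An element can only enter or leave a boundary of dimension [dim q] by
    crossing an element of at most that dimension. *)
Lemma bnd_conn s q u v :
  (forall t, betw u v t -> dim q < dim t) -> bnd s q u = bnd s q v.
Proof.
have imp u' v' : (forall t, betw u' v' t -> dim q < dim t) ->
    bnd s q u' -> bnd s q v'.
  move=> h /bndP[squ hu]; apply/bndP.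
  have nq : ~ betw u' v' q by move=> /h; rewrite ltnn.
  have sv : side s q v'.
    by move: squ nq; rewrite /betw; case: s {hu} => /=; lia.
  split=> // t tq tb.
  have [/h//|ntb] := pselect (betw u' v' t).
  apply: hu => //; move: squ sv tb ntb nq; rewrite /betw.
  by case: s => /=; lia.
move=> h; apply/idP/idP; apply: imp => // t tb; apply: h.
by move: tb; rewrite /betw; lia.
Qed.

Lemma bnd_uniq s q q' g : bnd s q g -> bnd s q' g -> dim q = dim q' -> q = q'.
Proof.
move=> /bndP[sq hq] /bndP[sq' hq'] e; apply: contrapT => ne.
have ne' : q <> q' :> nat by move=> /val_inj.
have : ~ betw q g q' by move=> /(hq _ (not_eq_sym ne)); lia.
have : ~ betw q' g q by move=> /(hq' _ ne); lia.
by rewrite /betw; move: sq sq' ne'; case: s {hq hq'} => /=; lia.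
Qed.

(** Globularity: from a face of [g] up to [g] all dimensions are at least that
    of the face. *)
Lemma bnd_glob s s' r g q : bnd s' r g -> dim q < dim r ->
  bnd s q r = bnd s q g.
Proof.
move=> /bndP[srg h] qr; apply: bnd_conn => t tb.
have [->//|/eqP tr] := eqVneq t r.
exact: ltn_trans qr (h _ tr tb).
Qed.

(** Walking from [g] to the end of the zigzag the dimension moves by steps of one
    down to 0, so the first value below [k.+1] is [k]. *)
Lemma bnd_ex s k g : k < dim g -> exists2 q, dim q = k & bnd s q g.
Proof.
pose d := if s is minus then nat_of_ord g else zlast z - g.
(* Induction on the distance from [g] to the end on the side [s]; [h] is the
   neighbour of [g] on that side. *)
have [j] : exists j, d <= j by exists d.
rewrite {}/d; elim: j g => [|j IH] g gj kg.
  exfalso; suff : dim g = 0 by lia.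
  case: s gj => gj.
    by rewrite -(zdim_first z); congr zdim; apply: val_inj => /=; lia.
  rewrite -(zdim_last z); congr zdim; apply: val_inj => /=.
  by have := ltn_ord g; lia.
suff [h [sh nb hd gh]] : exists h, [/\ side s h g,
    forall t, betw h g t -> t = h \/ t = g,
    dim h <= (dim g).+1 <= (dim h).+2
    & (if s is minus then nat_of_ord h else zlast z - h) <= j].
  have [hk|hk] := eqVneq (dim h) k.
    exists h => //; apply/bndP; split=> // t th /nb[//|->]; lia.
  have {}hk : k < dim h by lia.
  have [q qk qh] := IH h gh hk; exists q => //.
  by rewrite -(bnd_conn _ (u := h)) // => t /nb[->|->]; lia.
case: s gj {IH} => gj.
  have g0 : 0 < g.
    rewrite lt0n; apply/negP => /eqP g0; have := zdim_first z.
    by have -> : ord0 = g by [apply: val_inj; rewrite /= g0]; lia.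
  have lt : g.-1 < (zlast z).+1 by have := ltn_ord g; lia.
  exists (Ordinal lt); split=> /=.
  - lia.
  - move=> t; rewrite /betw /= => tb.
    have [e|e] : t = g.-1 :> nat \/ t = g :> nat by lia.
      by left; apply: val_inj.
    by right; apply: val_inj.
  - have /zdim_step : g = (Ordinal lt).+1 :> nat by rewrite /=; lia.
    by lia.
  - lia.
have g0 : g < zlast z.
  rewrite ltn_neqAle -ltnS ltn_ord andbT; apply/negP => /eqP g0.
  have := zdim_last z.
  by have -> : ord_max = g by [apply: val_inj; rewrite /= g0]; lia.
have lt : g.+1 < (zlast z).+1 by [].
exists (Ordinal lt); split=> /=.
- lia.
- move=> t; rewrite /betw /= => tb.
  have [e|e] : t = g.+1 :> nat \/ t = g :> nat by lia.
    by left; apply: val_inj.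
  by right; apply: val_inj.
- by have /zdim_step : (Ordinal lt) = g.+1 :> nat by []; lia.
- lia.
Qed.

Definition face s q g : bool := (dim g == (dim q).+1) && bnd s q g.

Lemma face_dim s q g : face s q g -> dim g = (dim q).+1.
Proof. by case/andP => /eqP. Qed.

Definition faces : incidence := Incidence face_dim.

(** The value [g] in dimension 0 is a default. *)
Definition zbd s g : I := odflt g [pick q | face s q g].

Lemma zbd_face s g : 0 < dim g -> face s (zbd s g) g.
Proof.
move=> g0; rewrite /zbd; case: pickP => //= no.
have [|q qk qg] := @bnd_ex s (dim g).-1 g; first by lia.
by move: (no q); rewrite /face qg qk prednK // eqxx.
Qed.

Lemma faceE s q g : face s q g = (0 < dim g) && (q == zbd s g).
Proof.
apply/idP/andP => [qg|[g0 /eqP->]]; last exact: zbd_face.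
have g0 : 0 < dim g by rewrite (face_dim qg).
split=> //; apply/eqP; have := zbd_face s g0 => /andP[/eqP d1 b1].
by move: qg => /andP[/eqP d2 b2]; apply: bnd_uniq b2 b1 _; lia.
Qed.

Lemma zbd_dim s g : 0 < dim g -> dim (zbd s g) = (dim g).-1.
Proof. by move=> /(zbd_face s) /face_dim ->. Qed.

Lemma zbd_bnd s g : 0 < dim g -> bnd s (zbd s g) g.
Proof. by move=> /(zbd_face s) /andP[]. Qed.

Lemma sum_face s g (F : I -> nat) :
  \sum_(q | face s q g) F q = if 0 < dim g then F (zbd s g) else 0.
Proof.
case: ifP => g0.
  by rewrite (big_pred1 (zbd s g)) // => q; rewrite faceE g0.
by rewrite big_pred0 // => q; rewrite faceE g0.
Qed.

(** * Atoms *)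

(** The cell generated by [g]: its part of sign [s] consists of [g] and of its
    iterated [s]-faces. *)
Definition atom g : sign -> I -> nat := fun s q => (q == g) || bnd s q g.

Lemma atom_level k s g : k <= dim g -> exists2 r, dim r = k &
  forall q, dim q = k -> atom g s q = (q == r).
Proof.
rewrite leq_eqVlt => /orP[/eqP kg|kg].
  exists g => // q qk; rewrite /atom; case: (q == g) => //=.
  by case: (boolP (bnd s q g)) => // /bnd_dim; lia.
have [r rk rg] := @bnd_ex s k g kg; exists r => // q qk; rewrite /atom.
have -> : (q == g) = false by apply/eqP => e; move: qk; rewrite e; lia.
congr (nat_of_bool _); apply/idP/eqP => [qg|->//].
by apply: bnd_uniq qg rg _; lia.
Qed.

Lemma sum_delta (P : pred I) r :
  \sum_(q | P q) (q == r : nat) = P r :> nat.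
Proof.
rewrite big_mkcond (bigD1 r) //= eqxx big1; first by case: (P r).
by move=> q /negbTE ->; case: ifP.
Qed.

(** Up to dimension [dim g] the chains of an atom are single basis elements, and
    the boundary equation is globularity. *)
Lemma atom_cell g : is_cell (I := faces) (atom g).
Proof.
split=> [s|s q].
  have [r r0 hr] := @atom_level 0 s g (leq0n _).
  rewrite (eq_bigr (fun q => (q == r : nat))); last by move=> q /eqP /hr.
  by rewrite sum_delta /= r0.
have [qg|gq] := ltnP (dim q) (dim g).
  have [r rk hr] := @atom_level (dim q).+1 s g qg.
  have E b : \sum_(g' | @iface faces b q g') atom g s g' = bnd b q g.
    rewrite (eq_bigr (fun q => (q == r : nat))); last first.
      by move=> h /face_dim /hr.
    rewrite sum_delta /= /face rk eqxx /=; congr nat_of_bool.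
    have := hr r rk; rewrite eqxx /atom; have [->//|_ /=] := eqVneq r g.
    case rg: (bnd s r g) => // _.
    by apply: bnd_glob rg _; rewrite rk.
  rewrite !E /atom; have -> : (q == g) = false.
    by apply/eqP => e; move: qg; rewrite e ltnn.
  by rewrite addnC.
have E b : \sum_(g' | @iface faces b q g') atom g s g' = 0.
  apply: big1 => h /face_dim hq; rewrite /atom.
  have -> : (h == g) = false by apply/eqP => e; move: hq; rewrite e; lia.
  by case: (boolP (bnd s h g)) => // /bnd_dim; lia.
rewrite !E /atom.
have nb b : bnd b q g = false by apply/negP => /bnd_dim; lia.
by rewrite !nb.
Qed.

Lemma trunc_atom_id n a g : dim g <= n -> trunc (I := faces) n a (atom g) = atom g.
Proof.
move=> gn; apply: chain_eq => s q; rewrite /trunc /atom /=.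
have nb b : n <= dim q -> bnd b q g = false.
  by move=> nq; apply/negP => /bnd_dim; lia.
case: ltngtP => // qn; rewrite !nb ?qn //; last exact: ltnW.
by rewrite orbF; case: eqP => // e; move: qn; rewrite e; lia.
Qed.

Lemma trunc_atom_bd a g : 0 < dim g ->
  trunc (I := faces) (dim g).-1 a (atom g) = atom (zbd a g).
Proof.
move=> g0; apply: chain_eq => s q; rewrite /trunc /atom /=.
have ba := zbd_bnd a g0; have da := zbd_dim a g0.
case: ltngtP => qn.
- rewrite -(bnd_glob s ba) ?da //.
  have -> : (q == g) = false by apply/eqP => e; move: qn; rewrite e; lia.
  by case: eqP => // e; move: qn; rewrite e da ltnn.
- case: eqP => e; first by move: qn; rewrite e da ltnn.
  by case: (boolP (bnd s q (zbd a g))) => // /bnd_dim; lia.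
- have -> : (q == g) = false by apply/eqP => e; move: qn; rewrite e; lia.
  have -> : bnd s q (zbd a g) = false by apply/negP => /bnd_dim; lia.
  rewrite orbF /=; have := faceE a q g; rewrite g0 /= => <-.
  by rewrite /face qn prednK // eqxx.
Qed.

Lemma atom_inj g g' : atom g = atom g' -> g = g'.
Proof.
move=> e; have {}e s : atom g s g = atom g' s g by rewrite e.
have := e minus; have := e plus; rewrite /atom eqxx /=.
case: eqP => //= _; case: (boolP (in_delta_minus _ _ _)) => // h1.
case: (boolP (in_delta_plus _ _ _)) => // h2.
have := @bnd_side minus g g' h1; have := @bnd_side plus g g' h2 => /=; lia.
Qed.

(** * The globular set of a zigzag *)

Lemma zbd_bd a g : 2 <= dim g -> zbd a (zbd minus g) = zbd a (zbd plus g).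
Proof.
move=> g2; have g0 : 0 < dim g by lia.
have b s : bnd a (zbd a (zbd s g)) g.
  have d := zbd_dim s g0.
  rewrite -(bnd_glob a (zbd_bnd s g0)); first by apply: zbd_bnd; lia.
  by rewrite zbd_dim; lia.
by apply: bnd_uniq (b minus) (b plus) _; rewrite !zbd_dim ?zbd_dim; lia.
Qed.

Definition zglob : globular_set := GlobularSet zbd_dim zbd_bd.

Lemma zgstep_lt (x y : zglob) : gstep x y -> ((x : I) < (y : I)).
Proof.
by case=> t t0; [exact: bnd_side (zbd_bnd minus t0)
                |exact: bnd_side (zbd_bnd plus t0)].
Qed.

(** Neighbours in the zigzag differ by one in dimension, so the lower one is a
    face of the higher one. *)
Lemma zgstep_succ (x y : zglob) : (y : I) = (x : I).+1 :> nat -> gstep x y.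
Proof.
move=> xy; have adj t : betw x y t -> t = x \/ t = y.
  rewrite /betw => tb; have [/val_inj|/val_inj] : t = x :> nat \/ t = y :> nat.
  - lia. - by left. - by right.
have [d|d] := zdim_step xy.
  have y0 : 0 < dim y by lia.
  suff -> : x = zbd minus y by exact: (Gstep_minus (G := zglob)).
  apply/eqP; have := faceE minus x y; rewrite y0 /= => <-; rewrite /face d eqxx.
  apply/(bndP minus); split=> /=; first lia.
  by move=> t tx /adj[//|->]; rewrite d.
have x0 : 0 < dim x by lia.
suff -> : y = zbd plus x by exact: (Gstep_plus (G := zglob)).
apply/eqP; have := faceE plus y x; rewrite x0 /= => <-; rewrite /face d eqxx.
apply/(bndP plus); split=> /=; first lia.
move=> t ty tb; have [->|//] : t = x \/ t = y; last by rewrite d.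
by apply: adj; move: tb; rewrite /betw; lia.
Qed.

Lemma zgstep_trans (x y : zglob) :
  clos_trans zglob (@gstep zglob) x y <-> ((x : I) < (y : I)).
Proof.
split; first by elim=> [u v /zgstep_lt //|u v w _ uv _ vw]; exact: ltn_trans uv vw.
move=> xy; have [j] : exists j, y - x <= j by exists (y - x).
elim: j x y xy => [|j IH] x y xy xyj; first lia.
have [e|e] := eqVneq (nat_of_ord y) x.+1.
  by apply: t_step; exact: zgstep_succ.
have lt : x.+1 < (zlast z).+1 by have := ltn_ord y; lia.
apply: (t_trans _ _ _ (Ordinal lt : zglob)).
  by apply: t_step; exact: zgstep_succ.
by apply: IH => /=; lia.
Qed.

Lemma zglob_simple : simple_globular_set zglob.
Proof.
split; first exact: inhabits ord0.
  exact: (@finite_finset ('I_(zlast z).+1)).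
split=> [x /zgstep_trans|x y w /zgstep_trans xy /zgstep_trans yw|x y].
- by rewrite ltnn.
- by apply/zgstep_trans; exact: ltn_trans xy yw.
- have [xy|yx|/val_inj] := ltngtP (x : I) (y : I).
  + by constructor 1; apply/zgstep_trans.
  + by constructor 3; apply/zgstep_trans.
  + by constructor 2.
Qed.

End Zigzag.

(** * Arches and the cells they support *)

Section Arches.

Variable z : zigzag.
Local Notation I := 'I_(zlast z).+1.
Local Notation dim := (@zdim z).
Local Notation is_cell := (@is_cell (faces z)).
Local Notation trunc := (@trunc (faces z)).
Local Notation paste := (@paste (faces z)).
Local Notation composable := (@composable (faces z)).
Local Notation zbd := (@zbd z).
Implicit Types (q r g h a b m : I) (s t : sign) (x y : sign -> I -> nat).

(** An interval of the zigzag between two elements of equal dimension that never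
    goes below it. Its ends are parallel; with their iterated faces, which
    [within] adds, it is a sub-globular set. *)
Definition arch a b : Prop :=
  [/\ a <= b, dim a = dim b & forall q, a <= q <= b -> dim a <= dim q].

Definition within a b q : bool := [|| a <= q <= b, bnd minus q a | bnd plus q a].

Definition supp a b x : Prop := forall s q, x s q <> 0 -> within a b q.

Lemma within_high a b q : within a b q -> dim a <= dim q -> a <= q <= b.
Proof. by case/or3P => // /bnd_dim; lia. Qed.

Lemma within_bnd a b s r g : arch a b -> within a b g -> dim g <= dim a ->
  dim r < dim g -> bnd s r g = bnd s r a.
Proof.
move=> [ab dab lo] wg ga rg; case/or3P: wg => [gab|ga'|ga'].
- apply: bnd_conn => t tb; apply: leq_trans (leq_trans rg ga) (lo _ _).
  by move: tb; rewrite /betw; lia.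
- by rewrite -(bnd_glob s ga').
- by rewrite -(bnd_glob s ga').
Qed.

Lemma supp0 a b x s q : supp a b x -> ~~ within a b q -> x s q = 0.
Proof. by move=> sx nq; apply: contrapT => /sx; rewrite (negbTE nq). Qed.

Lemma supp_trunc a b n s x : supp a b x -> supp a b (trunc n s x).
Proof.
by move=> sx s' q; rewrite /trunc; case: ltngtP => // _; apply: sx.
Qed.

Lemma supp_paste a b n x y :
  supp a b x -> supp a b y -> supp a b (paste n x y).
Proof.
move=> sx sy s q; rewrite /paste; case: ltngtP => _; first exact: sx.
  have [->|/eqP /sx //] := eqVneq (x s q) 0; exact: sy.
by case: s; [apply: sx | apply: sy].
Qed.

Definition flip s : sign := if s is minus then plus else minus.

Definition mass k x s : nat := \sum_(q : I | dim q == k) x s q.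

Lemma bnd_flip s q g : bnd s q g -> bnd (flip s) q g = false.
Proof.
move=> sq; apply/negP => sq'; have := bnd_side sq; have := bnd_side sq'.
by case: s {sq sq'} => /=; lia.
Qed.

(** All elements of dimension [(dim r).+1] in the arch have the same faces as the
    end [a] or its iterated faces, so that in the boundary equation at [r] one
    side collapses to the total mass in that dimension. *)
Lemma mass_step a b x s t r : arch a b -> is_cell x -> supp a b x ->
  dim r < dim a -> bnd t r a ->
  mass (dim r).+1 x s + x (flip t) r = x t r.
Proof.
move=> ab [_ xb] sx ra rt.
have E c : \sum_(g | @iface (faces z) c r g) x s g =
    if bnd c r a then mass (dim r).+1 x s else 0.
  have [bc|nbc] := boolP (bnd c r a).
    rewrite /mass [LHS]big_mkcond [RHS]big_mkcond; apply: eq_bigr => g _.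
    rewrite /= /face; case: (dim g =P (dim r).+1) => //= gr.
    have [wg|/(supp0 s sx) ->] := boolP (within a b g); last by case: ifP.
    by rewrite (within_bnd c ab wg) ?bc //; lia.
  apply: big1 => g /andP[/eqP gr bg].
  apply: contrapT => /sx wg; move: nbc; rewrite -(within_bnd c ab wg) ?bg //; lia.
move: (xb s r); rewrite !E.
case: t rt => rt; rewrite rt; have /= -> := bnd_flip rt; lia.
Qed.

(** Up to the dimension of the arch, each chain of a cell is zero or a single
    basis element: by [mass_step] the mass in dimension [k.+1] does not depend on
    the sign and is at most the mass in dimension [k]. *)
Lemma mass_bool a b x k : arch a b -> is_cell x -> supp a b x ->
  k <= dim a -> exists e : bool, forall s, mass k x s = e.
Proof.
move=> ab cx sx; elim: k => [|k IH] ka.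
  by exists true => s; exact: cx.1.
have [e he] := IH (ltnW ka).
have [r rk ra] := @bnd_ex z plus k a ka.
have ms s := mass_step s ab cx sx (ltac:(lia) : dim r < dim a) ra.
have le : x plus r <= mass k x plus.
  by rewrite /mass (bigD1 r) ?rk //= leq_addr.
exists (0 < mass k.+1 x plus) => s.
move: (ms s) (ms plus) (he plus); rewrite rk /=; lia.
Qed.

Lemma mass_ge k x s q : dim q = k -> x s q <= mass k x s.
Proof. by move=> qk; rewrite /mass (bigD1 q) ?qk //= leq_addr. Qed.

Lemma mass_unique k x s j : mass k x s <= 1 -> dim j = k -> x s j <> 0 ->
  forall q, dim q = k -> x s q = (q == j).
Proof.
move=> m1 jk xj q qk; have [->|qj] := eqVneq q j.
  by have := mass_ge x s jk; lia.
move: m1; rewrite /mass (bigD1 j) ?jk //= (bigD1 q) ?qk ?eqxx ?qj //=; lia.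
Qed.

(** * The flow identity and its consequences *)

(** Sum the boundary equations over the elements of dimension [k] before position
    [c]: the two faces of an element of dimension [k.+1] cancel unless [c]
    separates them. *)
Lemma flow x k s (c : nat) : is_cell x ->
  \sum_(g : I | (dim g == k.+1) && (zbd minus g < c <= zbd plus g)) x s g +
  \sum_(q : I | (dim q == k) && (q < c)) x plus q =
  \sum_(q : I | (dim q == k) && (q < c)) x minus q.
Proof.
move=> [_ xb].
have E t : \sum_(q : I | (dim q == k) && (q < c))
      \sum_(g | @iface (faces z) t q g) x s g =
    \sum_(g : I | dim g == k.+1) (zbd t g < c) * x s g.
  rewrite (exchange_big_dep (fun g : I => dim g == k.+1)) /=; last first.
    by move=> q g /andP[/eqP <- _] /face_dim ->.
  apply: eq_bigr => g /eqP gk.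
  have g0 : 0 < dim g by rewrite gk.
  rewrite (eq_bigl (fun q => (q < c) && (q == zbd t g))); last first.
    move=> q; rewrite faceE g0 /=; case: (q =P _) => [->|]; last by rewrite !andbF.
    by rewrite zbd_dim // gk eqxx !andbT.
  have [lt|ge] := boolP (zbd t g < c).
    rewrite (big_pred1 (zbd t g)) ?mul1n // => q /=.
    by case: eqP => [->|]; rewrite ?lt ?andbF.
  by rewrite big_pred0 // => q; case: eqP => [->|]; rewrite ?andbF // (negbTE ge).
have : \sum_(q : I | (dim q == k) && (q < c))
    (\sum_(g | @iface (faces z) plus q g) x s g + x minus q) =
  \sum_(q : I | (dim q == k) && (q < c))
    (\sum_(g | @iface (faces z) minus q g) x s g + x plus q).
  by apply: eq_bigr => q _; exact: xb.
rewrite !big_split /= !E [X in X + _ = _ -> _]big_mkcond.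
rewrite [X in _ = X + _ -> _]big_mkcond [X in _ -> X + _ = _]big_mkcond /=.
have -> : \sum_(g : I) (if dim g == k.+1 then (zbd minus g < c) * x s g else 0) =
  \sum_(g : I) (if dim g == k.+1 then (zbd plus g < c) * x s g else 0) +
  \sum_(g : I) (if (dim g == k.+1) && (zbd minus g < c <= zbd plus g)
          then x s g else 0).
  rewrite -big_split; apply: eq_bigr => g _ /=.
  case: eqP => //= gk; have g0 : 0 < dim g by rewrite gk.
  have := bnd_side (zbd_bnd minus g0); have := bnd_side (zbd_bnd plus g0).
  rewrite /=; case: (ltnP (zbd minus g) c); case: (ltnP (zbd plus g) c) => /=; lia.
by rewrite -addnA => /addnI ->.
Qed.

(** If the two chains in dimension [k] agree then, by the flow identity, no
    element of dimension [k.+1] crosses any position, so the cell vanishes in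
    dimension [k.+1]; the argument then repeats one dimension higher. *)
Lemma no_loop x k : is_cell x ->
  (forall q, dim q = k -> x minus q = x plus q) ->
  forall s g, k < dim g -> x s g = 0.
Proof.
move=> cx; move: k.
have step k : (forall q, dim q = k -> x minus q = x plus q) ->
    forall s g, dim g = k.+1 -> x s g = 0.
  move=> e s g gk; have := flow k s (zbd minus g).+1 cx.
  have -> : \sum_(q : I | (dim q == k) && (q < (zbd minus g).+1)) x plus q =
      \sum_(q : I | (dim q == k) && (q < (zbd minus g).+1)) x minus q.
    by apply: eq_bigr => q /andP[/eqP qk _]; rewrite e.
  move/(canRL (addnK _)); rewrite subnn (bigD1 g) /=; first lia.
  rewrite gk eqxx ltnSn /=; have g0 : 0 < dim g by rewrite gk.
  have := bnd_side (zbd_bnd minus g0); have := bnd_side (zbd_bnd plus g0).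
  by rewrite /=; lia.
move=> k e s g kg.
have [j] : exists j, dim g = k + j.+1 by exists (dim g - k.+1); lia.
elim: j k e {kg} => [|j IH] k e gj; first by apply: step e _ _ _; lia.
by apply: (IH k.+1) => [q /(step k e) xq|]; rewrite ?xq //; lia.
Qed.

Lemma no_loop_trunc x k s : is_cell x ->
  (forall q, dim q = k -> x minus q = x plus q) -> trunc k s x = x.
Proof.
move=> cx e; apply: chain_eq => s' q; rewrite /trunc.
case: ltngtP => // qk; first by rewrite (no_loop cx e).
by case: s; case: s'; rewrite // e.
Qed.

Lemma level_split a b x s k rm rp : arch a b -> supp a b x -> k < dim a ->
  dim rm = k -> dim rp = k -> bnd minus rm a -> bnd plus rp a ->
  mass k x s = x s rm + x s rp /\
  forall q, dim q = k -> q <> rm -> q <> rp -> x s q = 0.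
Proof.
move=> ab sx ka mk pk ma pa.
have z0 q : dim q = k -> q <> rm -> q <> rp -> x s q = 0.
  move=> qk qm qp; apply: contrapT => /sx /or3P[qab|qa|qa].
  - by case: ab => _ _ /(_ q qab); lia.
  - by apply: qm; apply: bnd_uniq qa ma _; lia.
  - by apply: qp; apply: bnd_uniq qa pa _; lia.
split=> //; rewrite /mass (bigD1 rm) ?mk //= (bigD1 rp) /=; last first.
  rewrite pk eqxx /=; apply/eqP => e; have := bnd_side ma.
  by have := bnd_side pa; rewrite e /=; lia.
by rewrite big1 ?addn0 // => q /andP[/andP[/eqP qk /eqP qm] /eqP qp]; exact: z0.
Qed.

(** Below its dimension an arch is a single globe, and two cells of a globe are
    composable only if one of them is an identity. *)
Lemma low_identity a b x y k : arch a b -> is_cell x -> is_cell y ->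
  supp a b x -> supp a b y -> k < dim a -> composable k x y ->
  trunc k minus y = y \/ trunc k plus x = x.
Proof.
move=> ab cx cy sx sy ka /composableP[_ exy].
have [rm mk ma] := @bnd_ex z minus k a ka.
have [rp pk pa] := @bnd_ex z plus k a ka.
have key w : is_cell w -> supp a b w ->
  [/\ w minus rp <= w plus rp, w plus rp <= 1 &
      w minus rp = w plus rp -> forall s, trunc k s w = w].
  move=> cw sw.
  have [e he] := mass_bool ab cw sw (ltnW ka).
  have spl s := level_split s ab sw ka mk pk ma pa.
  have [m1 _] := spl minus; have [m2 _] := spl plus.
  split.
  - have := @mass_step a b w minus plus rp ab cw sw; rewrite pk.
    by move=> /(_ ka pa) /=; lia.
  - by have := mass_ge w plus pk; rewrite he; lia.
  move=> erp s; apply: no_loop_trunc => // q qk.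
  have [->|/eqP qm] := eqVneq q rm; first by rewrite !he in m1 m2; lia.
  have [->//|/eqP qp] := eqVneq q rp.
  by rewrite (spl minus).2 // (spl plus).2.
have [x1 x2 x3] := key x cx sx; have [y1 y2 y3] := key y cy sy.
have e := exy rp pk.
(* The coefficient at [rp] increases from x^- to x^+ = y^- to y^+ and is at most
   1, so one of the two steps is an equality. *)
have [ex|ex] := eqVneq (x minus rp) (x plus rp); first by right; apply: x3.
by left; apply: y3; lia.
Qed.

Lemma arch_refl a : arch a a.
Proof.
split=> // t ta; suff -> : t = a by [].
by apply: val_inj => /=; lia.
Qed.

Lemma within_refl a q : within a a q -> dim a <= dim q -> q = a.
Proof. by move=> wq aq; apply: val_inj => /=; have := within_high wq aq; lia. Qed.

Lemma globe_trunc a x n s : is_cell x -> supp a a x -> dim a <= n ->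
  trunc n s x = x.
Proof.
move=> cx sx an; apply: no_loop_trunc => // q qn.
have [e he] := mass_bool (arch_refl a) cx sx (leqnn _).
have [wq|nw] := boolP (within a a q); last by rewrite !(supp0 _ sx).
have {wq} -> := within_refl wq (ltac:(lia) : dim a <= dim q).
have m s' : mass (dim a) x s' = x s' a.
  rewrite /mass (bigD1 a) //= big1 ?addn0 // => h /andP[/eqP ha /eqP nha].
  apply: (supp0 _ sx); apply/negP => /within_refl; rewrite ha => /(_ (leqnn _)).
  exact: nha.
by rewrite -!m !he.
Qed.

(** The mass at the top is 1, hence by [mass_step] it is 1 in every lower
    dimension, and the position of the single element is forced. *)
Lemma globe_top a x s : is_cell x -> supp a a x -> x s a <> 0 -> x = atom a.
Proof.
move=> cx sx xa.
have m1 k s' : k <= dim a -> mass k x s' = 1.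
  move=> ka; have [j] : exists j, dim a = k + j by exists (dim a - k); lia.
  elim: j k s' ka => [|j IH] k s' ka aj.
    have ak : dim a = k by lia.
    have [e he] := mass_bool (arch_refl a) cx sx ka.
    by have := mass_ge x s ak; rewrite !he; lia.
  have lt : k < dim a by lia.
  have [r rk ra] := @bnd_ex z plus k a lt.
  have := @mass_step a a x plus plus r (arch_refl a) cx sx.
  rewrite rk => /(_ lt ra); rewrite (IH k.+1 plus lt) => [/= h|]; last lia.
  have [e he] := mass_bool (arch_refl a) cx sx ka.
  by have := mass_ge x plus rk; rewrite !he; lia.
apply: (chain_eq (I := faces z)) => t q; rewrite /atom.
have [qa|aq] := ltnP (dim q) (dim a); last first.
  have [->|nqa] := eqVneq q a.
    have := @mass_unique (dim a) x t a; rewrite m1 // => -> //; first by rewrite eqxx.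
    have := m1 (dim a) t (leqnn _).
    rewrite /mass (bigD1 a) //= big1 ?addn0 => [-> //|h].
    move=> /andP[/eqP ha /eqP nha]; apply: (supp0 _ sx); apply/negP.
    by move=> /within_refl; rewrite ha => /(_ (leqnn _)).
  have -> : bnd t q a = false by apply/negP => /bnd_dim; lia.
  apply: (supp0 _ sx); apply/negP => /within_refl /(_ aq) /eqP.
  by rewrite (negbTE nqa).
have -> : (q == a) = false by apply/eqP => e; move: qa; rewrite e ltnn.
rewrite /=.
have [qt|nqt] := boolP (bnd t q a).
  have := @mass_step a a x t t q (arch_refl a) cx sx qa qt.
  have := mass_ge x t (erefl (dim q)); rewrite !m1 //; last lia.
  by rewrite /=; lia.
have [qt|nqt'] := boolP (bnd (flip t) q a).
  have := @mass_step a a x t (flip t) q (arch_refl a) cx sx qa qt.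
  have := mass_ge x (flip t) (erefl (dim q)); rewrite !m1 //; last lia.
  by case: t nqt qt => /=; lia.
apply: (supp0 _ sx); apply/negP => /or3P[h|h|h].
- by have [_ _ /(_ q h)] := arch_refl a; lia.
- by case: t nqt nqt'; move: h => /= ->.
- by case: t nqt nqt'; move: h => /= ->.
Qed.

(** Either the top element [a] occurs, or the mass at the top is 0. Then the two
    chains one dimension lower agree, and the cell lies in one of the two faces
    of [a]. *)
Lemma globe_atom a x : is_cell x -> supp a a x ->
  exists2 g, within a a g & x = atom g.
Proof.
move=> cx; have [n] : exists n, dim a = n by exists (dim a).
elim: n a => [|n IH] a an sx.
  have [e he] := mass_bool (arch_refl a) cx sx (leqnn _).
  exists a; first by rewrite /within leqnn.
  apply: (globe_top (s := plus) cx sx) => xa.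
  have := cx.1 plus; rewrite big1 // => q /eqP q0; apply: contrapT => xq.
  have qa := within_refl (sx _ _ xq) (ltac:(rewrite an; lia) : dim a <= dim q).
  by apply: xq; rewrite qa.
have [xa|xa] := pselect (exists s, x s a <> 0).
  case: xa => s xa; exists a; first by rewrite /within leqnn.
  exact: globe_top xa.
have x0 s q : n < dim q -> x s q = 0.
  move=> qn; apply: contrapT => xq.
  have qa := within_refl (sx _ _ xq) (ltac:(lia) : dim a <= dim q).
  by apply: xa; exists s; rewrite -qa.
have lt : n < dim a by rewrite an.
have [rm mk ma] := @bnd_ex z minus n a lt.
have [rp pk pa] := @bnd_ex z plus n a lt.
have [e he] := mass_bool (arch_refl a) cx sx (ltnW lt).
have spl s := level_split s (arch_refl a) sx lt mk pk ma pa.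
have := @mass_step a a x plus plus rp (arch_refl a) cx sx.
rewrite pk => /(_ lt pa); rewrite /mass big1 /= => [erp|q /eqP qn]; last first.
  by apply: x0; rewrite qn.
(* [r] is the face of [a] in whose globe the cell lies. *)
suff [r [t [rn ra hr]]] : exists r t, [/\ dim r = n, bnd t r a &
    forall s q, dim q = n -> q <> r -> x s q = 0].
  have sr : supp r r x.
    move=> s q xq; have qn : dim q <= n.
      by rewrite leqNgt; apply/negP => /(x0 s).
    have [qr|/eqP qr] := eqVneq q r; first by rewrite qr /within leqnn.
    have {}qn : dim q < n.
      by rewrite ltn_neqAle qn andbT; apply/eqP => e'; apply: xq; apply: hr.
    rewrite /within !(bnd_glob _ ra) ?rn //.
    case/or3P: (sx _ _ xq) => [h|->|->]; rewrite ?orbT //.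
    by have [_ _ /(_ q h)] := arch_refl a; lia.
  have [g wg xg] := IH r rn sr; exists g => //.
  case/or3P: wg => [gr|gr|gr].
  - have -> : g = r by apply: val_inj => /=; lia.
    by rewrite /within; case: t ra {hr sr} => ->; rewrite ?orbT.
  - by rewrite /within -(bnd_glob minus ra) ?gr ?orbT //; exact: bnd_dim gr.
  - by rewrite /within -(bnd_glob plus ra) ?gr ?orbT //; exact: bnd_dim gr.
have [m1 m1'] := spl minus; have [m2 m2'] := spl plus.
rewrite !he in m1 m2.
have [rp0|rp0] := posnP (x plus rp).
  exists rm, minus; split=> // s q qn qm.
  have [->|/eqP qp] := eqVneq q rp; first by case: s; lia.
  by case: s; [apply: m1' | apply: m2'].
exists rp, plus; split=> // s q qn qp.
have [->|/eqP qm] := eqVneq q rm; first by case: s; lia.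
by case: s; [apply: m1' | apply: m2'].
Qed.

End Arches.

(** * Splitting an arch at an interior minimum *)

Section Clamp.

Variable z : zigzag.
Local Notation I := 'I_(zlast z).+1.
Local Notation dim := (@zdim z).
Local Notation is_cell := (@is_cell (faces z)).
Local Notation trunc := (@trunc (faces z)).
Local Notation paste := (@paste (faces z)).
Local Notation composable := (@composable (faces z)).
Local Notation zbd := (@zbd z).
Implicit Types (q r g h a b m : I) (s t : sign) (x y : sign -> I -> nat).

(** Retraction of an arch containing [m] onto the part that does not lie on the
    [t]-side of [m]: elements on that side are sent to [m] if they have its
    dimension, and to zero if they have a higher one. *)
Definition clamp t m g : option I :=
  if (dim g < dim m) || ~~ side t g m then Some g
  else if dim g == dim m then Some m else None.

Definition clamp_mx t m (g q : faces z) : nat := clamp t m g == Some q.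

Definition clampx t m x : sign -> I -> nat := push (clamp_mx t m) x.

Lemma clamp_graded t m : graded_matrix (clamp_mx t m).
Proof.
move=> g q /=; rewrite /clamp_mx /clamp => gq.
case: ifP => _; first by case: eqP => // -[e]; rewrite e in gq.
case: (dim g =P dim m) => [gm|_] //.
by case: eqP => // -[e]; rewrite gm e in gq.
Qed.

(** The path from [g] to its face stays above the dimension of the face, so it
    does not pass [m]. *)
Lemma clamp_zbd s t m g : dim m < dim g ->
  (side t g m -> zbd s g = m \/ side t (zbd s g) m) /\
  (~~ side t g m -> ~~ side t (zbd s g) m).
Proof.
move=> mg; have g0 : 0 < dim g by lia.
have [sg nb] := (bndP _ _ _).1 (zbd_bnd s g0).
have dh := zbd_dim s g0.
have [->|/eqP hm] := eqVneq (zbd s g) m.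
  by split; [left | case: t => /=; rewrite ltnn].
have {}nb : ~ betw (zbd s g) g m.
  by move=> /(nb m (not_eq_sym hm)); rewrite dh; lia.
have gm : g <> m :> nat by move=> /val_inj e; move: mg; rewrite e ltnn.
have hm' : zbd s g <> m :> nat by move=> /val_inj.
by move: nb; rewrite /betw; split; [move=> gt; right; move: gt|];
  case: t => /=; lia.
Qed.

Lemma within_between a b m : a <= m <= b -> within a b m.
Proof. by move=> amb; rewrite /within amb. Qed.

(** On the elements of an arch the clamp is a chain map: elements of the dimension
    of [m] have the same faces as [m], and the two faces of a killed element have
    the same image. *)
Lemma clamp_chain t a b m g : arch a b -> a <= m <= b -> dim m = dim a ->
  within a b g -> chain_at (clamp_mx t m) g.
Proof.
move=> ab amb ma wg.
have sumA s q g' : \sum_(q' | @iface (faces z) s q q') (Some g' == Some q' :> option I : nat)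
    = @face z s q g'.
  rewrite -(@sum_delta z (fun q' => @face z s q q') g') /=; apply: eq_bigr => q' _.
  by congr (nat_of_bool _); rewrite eq_sym.
have nside : dim g = dim m -> forall s q, @face z s q m = @face z s q g.
  move=> gm s q; rewrite /face gm; case: eqP => //= d.
  rewrite (within_bnd s ab wg) ?(within_bnd s ab (within_between amb)) //; lia.
split=> [g0|q].
  have [g' g'0 e] : exists2 g', dim g' = 0 & clamp t m g = Some g'.
    rewrite /clamp; case: ifP => [_|/negbT/norP[gm _]]; first by exists g.
    case: eqP => [gm'|gm']; first by exists m; rewrite // -gm'.
    by move: g0 gm gm' => /=; lia.
  rewrite /clamp_mx e.
  rewrite (eq_bigr (fun q => (q == g' : nat))).
    by rewrite (@sum_delta z) /= g'0.
  by move=> q _; congr (nat_of_bool _); rewrite eq_sym.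
rewrite !(@sum_face z) /clamp_mx.
have [keep|/norP[gm]] := boolP ((dim g < dim m) || ~~ side t g m).
  have -> : clamp t m g = Some g by rewrite /clamp keep.
  rewrite !sumA; case: ifP => g0; last by rewrite !faceE g0.
  have e s : clamp t m (zbd s g) = Some (zbd s g).
    rewrite /clamp; have [//|nlt] := ltnP (dim (zbd s g)) (dim m) => /=.
    have gm : dim m < dim g by rewrite zbd_dim // in nlt; lia.
    have [_ ->//] := clamp_zbd s t gm.
    by case/orP: keep => //; lia.
  rewrite !e !faceE g0 /= addnC.
  have c s : (Some (zbd s g) == Some q) = (q == zbd s g).
    by rewrite eq_sym; apply/eqP/eqP => [[]|->].
  by rewrite !c.
rewrite negbK => bey.
case: (dim g =P dim m) => [gm'|ngm].
  have -> : clamp t m g = Some m by rewrite /clamp gm' ltnn bey eqxx.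
  rewrite !sumA !nside //; case: ifP => g0; last by rewrite !faceE g0.
  have e s : clamp t m (zbd s g) = Some (zbd s g).
    rewrite /clamp zbd_dim // gm'.
    by have -> : (dim m).-1 < dim m by move: g0; rewrite gm' /=; lia.
  rewrite !e !faceE g0 /= addnC.
  have c s : (Some (zbd s g) == Some q) = (q == zbd s g).
    by rewrite eq_sym; apply/eqP/eqP => [[]|->].
  by rewrite !c.
have mg : dim m < dim g by move: gm => /=; lia.
have -> : clamp t m g = None.
  by rewrite /clamp bey orbF; case: ltngtP mg.
rewrite !big1 //=.
have -> : 0 < dim g by lia.
suff e : clamp t m (zbd minus g) = clamp t m (zbd plus g) by rewrite e.
have g0 : 0 < dim g by lia.
have [mg'|mg'] := eqVneq (dim g) (dim m).+1.
  have c s : clamp t m (zbd s g) = Some m.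
    rewrite /clamp zbd_dim // mg' /= ltnn eqxx /=.
    have [/(_ bey) [->|->] _] := clamp_zbd s t mg => //.
    by case: ifP.
  by rewrite !c.
have c s : clamp t m (zbd s g) = None.
  rewrite /clamp zbd_dim //.
  have -> : ((dim g).-1 < dim m) = false by lia.
  have -> : ((dim g).-1 == dim m) = false by lia.
  have [/(_ bey) [e _|-> //]] := clamp_zbd s t mg.
  by move: (zbd_dim s g0); rewrite e; lia.
by rewrite !c.
Qed.

Lemma clampx_cell t a b m x : arch a b -> a <= m <= b -> dim m = dim a ->
  is_cell x -> supp a b x -> is_cell (clampx t m x).
Proof.
move=> ab amb ma cx sx; apply: push_cell => //; first exact: clamp_graded.
by move=> s g /sx; exact: clamp_chain.
Qed.

Lemma clampx_trunc t m n s x : clampx t m (trunc n s x) = trunc n s (clampx t m x).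
Proof. exact: push_trunc (@clamp_graded t m). Qed.

Lemma clampx_paste t m n x y :
  clampx t m (paste n x y) = paste n (clampx t m x) (clampx t m y).
Proof. exact: push_paste (@clamp_graded t m). Qed.

Lemma clampx_composable t m n x y : composable n x y ->
  composable n (clampx t m x) (clampx t m y).
Proof. exact: push_composable (@clamp_graded t m). Qed.

Lemma clampx_neq0 t m x s q : clampx t m x s q <> 0 ->
  exists2 g, x s g <> 0 & clamp t m g = Some q.
Proof.
move=> /sum_pos_neq0[g _]; rewrite /clamp_mx => h; exists g.
  by move=> e; apply: h; rewrite e.
by apply/eqP; apply: contrapT => /negP/negbTE e; apply: h; rewrite e muln0.
Qed.

Lemma clampx_delta t m x s q j :
  (forall g, dim g = dim q -> x s g = (g == j)) -> dim j = dim q ->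
  clampx t m x s q = (clamp t m j == Some q).
Proof.
move=> hx jq; rewrite /clampx /push (bigD1 j) //= hx // eqxx mul1n big1 ?addn0 //.
move=> g /negbTE gj; have [gq|/eqP gq] := eqVneq (dim g) (dim q).
  by rewrite hx // gj.
by rewrite (clamp_graded t m gq) muln0.
Qed.

Lemma clampx_keep t m x s q :
  (forall g, x s g <> 0 -> clamp t m g = Some q -> g = q) ->
  clampx t m x s q = x s q * (clamp t m q == Some q).
Proof.
move=> h; rewrite /clampx /push (bigD1 q) //= big1 ?addn0 // => g gq.
have [->//|/eqP xg] := eqVneq (x s g) 0; rewrite /clamp_mx.
case: eqP => [/(h g xg) e|_]; last by rewrite muln0.
by rewrite e eqxx in gq.
Qed.

Lemma clamp_Some t m g q : clamp t m g = Some q -> g = q \/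
  [/\ q = m, dim g = dim m & side t g m].
Proof.
rewrite /clamp; case: ifP => [_ [->]|/negbT/norP[_]]; first by left.
by rewrite negbK => sg; case: eqP => // gm [<-]; right.
Qed.

Lemma clampx_low t m x s q : dim q < dim m -> clampx t m x s q = x s q.
Proof.
move=> qm; rewrite clampx_keep; first by rewrite /clamp qm eqxx muln1.
by move=> g _ /clamp_Some [//|[e _ _]]; move: qm; rewrite e ltnn.
Qed.

Lemma clampx_high t m x s q : dim m < dim q ->
  clampx t m x s q = if side t q m then 0 else x s q.
Proof.
move=> qm; rewrite clampx_keep.
  rewrite /clamp ltnNge (ltnW qm) /= gtn_eqF //.
  by case: (side t q m); rewrite /= ?muln0 // eqxx muln1.
by move=> g _ /clamp_Some [//|[e _ _]]; move: qm; rewrite e ltnn.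
Qed.

Lemma clampx_id t m x :
  (forall s g, x s g <> 0 -> dim g < dim m \/ ~~ side t g m) ->
  clampx t m x = x.
Proof.
move=> h; apply: (chain_eq (I := faces z)) => s q; rewrite clampx_keep.
  have [->//|/eqP xq] := eqVneq (x s q) 0.
  by rewrite /clamp; case: (h s q xq) => ->; rewrite ?orbT eqxx muln1.
move=> g xg /clamp_Some [//|[_ gm sg]].
by case: (h s g xg); [lia | rewrite sg].
Qed.

Lemma side_flip t q m : side t q m -> ~~ side (flip t) q m.
Proof. by case: t => /=; lia. Qed.

Section Split.

Variables (a b m : I).
Hypotheses (ab : arch a b) (amb : a <= m <= b) (ma : dim m = dim a).

Lemma arch_left : arch a m.
Proof.
by case: ab => ab1 ab2 lo; split=> [||t tb]; [lia | | apply: lo; lia].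
Qed.

Lemma arch_right : arch m b.
Proof.
by case: ab => ab1 ab2 lo; split=> [||t tb]; [lia | lia | rewrite ma; apply: lo; lia].
Qed.

Lemma bnd_mid s q : dim q < dim m -> bnd s q m = bnd s q a.
Proof.
by move=> qm; apply: (within_bnd _ ab (within_between amb)); rewrite // ma.
Qed.

Lemma within_cases q : within a b q ->
  (dim q < dim m /\ (bnd minus q m || bnd plus q m)) \/
  (dim m <= dim q /\ a <= q <= b).
Proof.
case/or3P => [qab|qa|qa].
- by right; split=> //; case: ab => _ _ lo; rewrite ma lo.
- have qm : dim q < dim m by rewrite ma; exact: bnd_dim qa.
  by left; rewrite bnd_mid // qa.
- have qm : dim q < dim m by rewrite ma; exact: bnd_dim qa.
  by left; rewrite (bnd_mid plus) // qa orbT.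
Qed.

Lemma within_left q : within a m q <->
  (dim q < dim m /\ (bnd minus q m || bnd plus q m)) \/
  (dim m <= dim q /\ a <= q <= m).
Proof.
split=> [/or3P[qam|qa|qa]|[[qm]|[mq amq]]].
- by right; split=> //; case: ab => _ _ lo; rewrite ma; apply: lo; lia.
- have qm : dim q < dim m by rewrite ma; exact: bnd_dim qa.
  by left; rewrite bnd_mid // qa.
- have qm : dim q < dim m by rewrite ma; exact: bnd_dim qa.
  by left; rewrite (bnd_mid plus) // qa orbT.
- by rewrite !bnd_mid // /within => ->; rewrite orbT.
- by rewrite /within amq.
Qed.

Lemma within_right q : within m b q <->
  (dim q < dim m /\ (bnd minus q m || bnd plus q m)) \/
  (dim m <= dim q /\ m <= q <= b).
Proof.
split=> [/or3P[qam|qa|qa]|[[qm]|[mq amq]]].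
- by right; split=> //; case: ab => _ _ lo; rewrite ma; apply: lo; lia.
- by left; rewrite (bnd_dim qa) qa.
- by left; rewrite (bnd_dim qa) qa orbT.
- by rewrite /within => ->; rewrite orbT.
- by rewrite /within amq.
Qed.

Lemma within_left_sub q : within a m q -> within a b q.
Proof.
case/or3P => [qam|qa|qa]; rewrite /within ?qa ?orbT //.
by have -> : a <= q <= b by lia.
Qed.

Lemma within_right_sub q : within m b q -> within a b q.
Proof.
case/or3P => [qam|qm|qm]; rewrite /within.
- by have -> : a <= q <= b by lia.
- by rewrite -(bnd_mid minus (bnd_dim qm)) qm orbT.
- by rewrite -(bnd_mid plus (bnd_dim qm)) qm !orbT.
Qed.

Lemma supp_right_sub x : supp m b x -> supp a b x.
Proof. by move=> sx s q /sx; exact: within_right_sub. Qed.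

Lemma supp_clamp_left x : supp a b x -> supp a m (clampx plus m x).
Proof.
move=> sx s q /clampx_neq0[g /sx /within_cases wg].
rewrite /clamp; case: ifP => [keep [<-]|_].
  apply/within_left; case: wg => [|[gm gab]]; [by left | right; split=> //].
  by move: keep => /=; lia.
case: eqP => // _ [<-]; apply/within_left; right; split=> //; lia.
Qed.

Lemma supp_clamp_right x : supp a b x -> supp m b (clampx minus m x).
Proof.
move=> sx s q /clampx_neq0[g /sx /within_cases wg].
rewrite /clamp; case: ifP => [keep [<-]|_].
  apply/within_right; case: wg => [|[gm gab]]; [by left | right; split=> //].
  by move: keep => /=; lia.
case: eqP => // _ [<-]; apply/within_right; right; split=> //; lia.
Qed.

Lemma clamp_left_id x : supp a m x -> clampx plus m x = x.
Proof.
move=> sx; apply: clampx_id => s g /sx /within_left.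
by case=> -[h1 h2]; [left | right => /=; lia].
Qed.

Lemma clamp_right_id x : supp m b x -> clampx minus m x = x.
Proof.
move=> sx; apply: clampx_id => s g /sx /within_right.
by case=> -[h1 h2]; [left | right => /=; lia].
Qed.

(** If the [t]-boundary in the dimension of [m] has no part strictly on the
    [t]-side of [m], then by the flow identity the other boundary has none
    either. The complementary clamp, which keeps the [t]-side, then has equal
    boundaries in that dimension, so by [no_loop] it vanishes above it, which
    means that the cell has nothing on the [t]-side of [m]. *)
Lemma clamp_near_id t x : is_cell x -> supp a b x ->
  (forall q, dim q = dim m -> side t q m -> x t q = 0) ->
  clampx t m x = x.
Proof.
move=> cx sx near.
have [e he] := mass_bool ab cx sx (leqnn _).
rewrite -ma in he.
have near2 s q : dim q = dim m -> side t q m -> x s q = 0.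
  move=> qm sq.
  have xt : x t q = 0 by apply: near => //; case: t sq {near}.
  suff xf : x (flip t) q = 0 by case: s; case: t xt xf {sq near}.
  clear s xt.
  case: t near sq => /= near sq.
    have := flow (dim m) plus m cx.
    rewrite [RHS]big1; last by move=> r /andP[/eqP rm sr]; apply: near.
    have : x plus q <= \sum_(i < (zlast z).+1 | (dim i == dim m) && (i < m)) x plus i.
      by rewrite (bigD1 q) /= ?leq_addr // qm eqxx sq.
    lia.
  have := flow (dim m) plus m.+1 cx.
  have := he plus; have := he minus; rewrite /mass.
  rewrite (bigID (fun q => q < m.+1)) /= => h1.
  rewrite (bigID (fun q => q < m.+1)) /= => h2.
  have : \sum_(i < (zlast z).+1 | (dim i == dim m) && ~~ (i < m.+1)) x plus i = 0.
    apply: big1 => r /andP[/eqP rm sr]; apply: near => //; lia.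
  have : x minus q <= \sum_(i < (zlast z).+1 | (dim i == dim m) && ~~ (i < m.+1)) x minus i.
    by rewrite (bigD1 q) /= ?leq_addr // qm eqxx /=; lia.
  have arith (st pl mi rp rm u : nat) : mi + rm = e -> pl + rp = e ->
    u <= rm -> rp = 0 -> st + pl = mi -> u = 0 by lia.
  exact: arith h1 h2.
(* The part of the cell on the [t]-side of [m]. *)
pose y := clampx (flip t) m x.
have cy : is_cell y := clampx_cell _ ab amb ma cx sx.
have y0 : forall s g, dim m < dim g -> y s g = 0.
  apply: no_loop => // q qm.
  have [->|qnm] := eqVneq q m; last first.
    have yz s : y s q = 0.
      apply: contrapT => /clampx_neq0[g xg cg].
      have [e'|[e' _ _]] := clamp_Some cg; last by rewrite e' eqxx in qnm.
      rewrite {}e' in xg cg; have nsq : ~~ side t q m.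
        by apply/negP => sq; apply: xg; apply: near2.
      move: cg; rewrite /clamp qm ltnn eqxx /=.
      have -> : side (flip t) q m.
        have : q <> m :> nat by move=> /val_inj /eqP; rewrite (negbTE qnm).
        by case: t nsq {y cy near near2} => /=; lia.
      by case=> e'; rewrite e' eqxx in qnm.
    by rewrite !yz.
  suff ym s : y s m = e by rewrite !ym.
  rewrite -(he s) /mass big_mkcond; apply: eq_bigr => g _ /=.
  have [gm|gm] := eqVneq (dim g) (dim m); last first.
    by rewrite (@clamp_graded (flip t) m) ?muln0 //; apply/eqP.
  have [->//|/eqP xg] := eqVneq (x s g) 0.
  suff cm : clamp (flip t) m g = Some m by rewrite /clamp_mx cm eqxx muln1.
  rewrite /clamp gm ltnn eqxx /=; case: ifP => [nf|_ //]; congr Some.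
  have nt : ~~ side t g m by apply/negP => sg; apply: xg; apply: near2.
  by apply: val_inj; case: t nf nt {y cy near near2} => /=; lia.
apply: clampx_id => s g xg.
have [gm|mg] := ltnP (dim g) (dim m); [by left | right; apply/negP => sg].
have [gm|gm] := eqVneq (dim g) (dim m).
  by apply: xg; apply: near2.
have {}mg : dim m < dim g by rewrite ltn_neqAle eq_sym gm.
apply: xg; rewrite -(y0 s g mg) /y clampx_high //.
by rewrite (negbTE (side_flip sg)).
Qed.

Definition crosses t x : Prop :=
  exists q, [/\ dim q = dim m, side t q m & x t q <> 0].

Lemma not_crosses t x : is_cell x -> supp a b x -> ~ crosses t x ->
  clampx t m x = x.
Proof.
move=> cx sx nc; apply: clamp_near_id => // q qm sq.
by apply: contrapT => xq; apply: nc; exists q.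
Qed.

Lemma supp_not_crosses_left x : supp a m x -> ~ crosses plus x.
Proof. by move=> sx [q [qm /= sq /sx /within_left]]; lia. Qed.

Lemma supp_not_crosses_right x : supp m b x -> ~ crosses minus x.
Proof. by move=> sx [q [qm /= sq /sx /within_right]]; lia. Qed.

Lemma level_delta x s j : is_cell x -> supp a b x -> dim j = dim m ->
  x s j <> 0 -> forall q, dim q = dim m -> x s q = (q == j).
Proof.
move=> cx sx jm xj q qm; apply: (mass_unique _ jm xj qm).
have [e he] := mass_bool ab cx sx (leqnn _).
by rewrite ma he; case: e {he}.
Qed.

Lemma supp_both x : supp a m x -> supp m b x -> supp m m x.
Proof.
move=> s1 s2 s q xq; have /within_left w1 := s1 _ _ xq.
have /within_right w2 := s2 _ _ xq; rewrite /within.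
case: w1 => [[_ ->]|w1]; first by rewrite orbT.
case: w2 => [[_ ->]|w2]; first by rewrite orbT.
by have -> : m <= q <= m by lia.
Qed.

(** A cell whose boundaries in the dimension of [m] lie strictly on both sides of
    [m] is cut by [m] into two cells. *)
Lemma clamp_split x : is_cell x -> supp a b x ->
  crosses plus x -> crosses minus x ->
  composable (dim m) (clampx plus m x) (clampx minus m x) /\
  paste (dim m) (clampx plus m x) (clampx minus m x) = x.
Proof.
move=> cx sx [j [jm sj xj]] [i [im si xi]].
have hj := level_delta cx sx jm xj; have hi := level_delta cx sx im xi.
have pj t q : dim q = dim m ->
    clampx t m x plus q = (clamp t m j == Some q).
  move=> qm; apply: clampx_delta => [g gq|]; last by rewrite qm.
  by apply: hj; rewrite gq.
have pi t q : dim q = dim m ->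
    clampx t m x minus q = (clamp t m i == Some q).
  move=> qm; apply: clampx_delta => [g gq|]; last by rewrite qm.
  by apply: hi; rewrite gq.
have cj : clamp plus m j = Some m by rewrite /clamp jm ltnn sj eqxx.
have ci : clamp minus m i = Some m by rewrite /clamp im ltnn si eqxx.
have ci' : clamp plus m i = Some i.
  by rewrite /clamp im ltnn; move: si => /= si; rewrite -leqNgt (ltnW si).
have cj' : clamp minus m j = Some j.
  by rewrite /clamp jm ltnn; move: sj => /= sj; rewrite -leqNgt (ltnW sj).
split.
  apply/composableP; split=> [s q qm|q qm]; first by rewrite !clampx_low.
  by rewrite pj // pi // cj ci.
apply: (chain_eq (I := faces z)) => s q; rewrite /paste.
case: ltngtP => qm.
- by rewrite clampx_low.
- rewrite !clampx_high //=; case: (ltngtP q m) => //= e; rewrite ?addn0 //.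
  by move: qm; rewrite (val_inj e) ltnn.
- case: s.
    rewrite pi // ci' hi //.
    by congr (nat_of_bool _); rewrite eq_sym; apply/eqP/eqP => [[->]|->].
  rewrite pj // cj' hj //.
  by congr (nat_of_bool _); rewrite eq_sym; apply/eqP/eqP => [[->]|->].
Qed.

End Split.

(** * Induction on arches *)

Lemma bnd_adjacent s q g (h : I) : dim q < dim g -> dim q < dim h ->
  (h = g.+1 :> nat \/ g = h.+1 :> nat) -> bnd s q g = bnd s q h.
Proof.
move=> qg qh gh; apply: bnd_conn => t tb.
have [/val_inj ->|/val_inj ->] // : t = g :> nat \/ t = h :> nat.
by move: tb; rewrite /betw; lia.
Qed.

(** An arch is one element, or has an interior element of its own dimension at
    which it splits, or becomes, on removal of its two ends, an arch one
    dimension higher that spans the same globular set. *)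
Lemma arch_ind (Q : I -> I -> Prop) :
  (forall a, Q a a) ->
  (forall a b m, arch a b -> a <= m <= b -> dim m = dim a ->
     Q a m -> Q m b -> Q a b) ->
  (forall a b a' b', within a b =1 within a' b' -> Q a' b' -> Q a b) ->
  forall a b, arch a b -> Q a b.
Proof.
move=> Q0 Qsplit Qext a b; have [n] : exists n, b - a <= n by exists (b - a).
elim: n a b => [|n IH] a b abn ab; have [le dab lo] := ab.
  suff -> : a = b by apply: Q0.
  by apply: val_inj => /=; lia.
have [e|ne] := eqVneq a b; first by rewrite e.
have {ne} lt : a < b.
  by rewrite ltn_neqAle le andbT; apply/negP => /eqP /val_inj /eqP; rewrite (negbTE ne).
have [[m [amb ma]]|nomid] := pselect (exists m : I, a < m < b /\ dim m = dim a).
  have amb' : a <= m <= b by lia.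
  apply: (Qsplit a b m) => //; apply: IH; try lia.
    exact: arch_left ab amb' ma.
  exact: arch_right ab amb' ma.
have la : a.+1 < (zlast z).+1 by have := ltn_ord b; lia.
have lb : b.-1 < (zlast z).+1 by have := ltn_ord b; lia.
pose a' : I := Ordinal la; pose b' : I := Ordinal lb.
have da : dim a' = (dim a).+1.
  have := @zdim_step z a a' erefl; have := lo a'; rewrite /=; lia.
have db : dim b' = (dim a).+1.
  have := @zdim_step z b' b; have := lo b'; rewrite /=; lia.
have lt' : a.+1 < b.
  rewrite ltn_neqAle lt andbT; apply/eqP => e; move: da.
  by have -> : a' = b by [apply: val_inj]; lia.
apply: (Qext a b a' b'); last first.
  apply: IH; rewrite /=; first lia.
  split=> [||q qab]; rewrite ?da ?db //=; first lia.
  move: qab => /= qab; rewrite ltn_neqAle lo ?andbT; last lia.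
  by apply/eqP => e; apply: nomid; exists q; split; [lia | rewrite e].
have ma : bnd minus a a'.
  apply/(bndP minus); split=> //= t /eqP ta tb; suff -> : t = a' by rewrite da.
  apply: val_inj; move: tb; rewrite /betw /=.
  by have /eqP : t <> a :> nat by [move=> /val_inj /eqP; rewrite (negbTE ta)]; lia.
have pb : bnd plus b a'.
  apply/(bndP plus); split=> //= t /eqP tb' tb; rewrite -dab.
  have tnb : t <> b :> nat by move=> /val_inj /eqP; rewrite (negbTE tb').
  rewrite ltn_neqAle lo ?andbT; last by move: tb; rewrite /betw /=; lia.
  apply/eqP => e; apply: nomid; exists t; rewrite e; split=> //.
  by move: tb; rewrite /betw /=; lia.
have eb s q : dim q < dim a -> bnd s q a = bnd s q a'.
  by move=> qa; apply: bnd_adjacent; [ | rewrite da; lia | left].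
move=> q; apply/idP/idP => [/or3P[qab|qa|qa]|/or3P[qab|qa|qa]]; rewrite /within.
- have [e|ea] := eqVneq q a; first by rewrite e ma orbT.
  have [e|ebb] := eqVneq q b; first by rewrite e pb !orbT.
  have {ea}ea : q <> a :> nat by move=> /val_inj /eqP; rewrite (negbTE ea).
  have {ebb}ebb : q <> b :> nat by move=> /val_inj /eqP; rewrite (negbTE ebb).
  by have -> : a' <= q <= b' by rewrite /=; lia.
- by rewrite -(eb minus) ?qa ?orbT //; exact: bnd_dim qa.
- by rewrite -(eb plus) ?qa ?orbT //; exact: bnd_dim qa.
- by have -> : a <= q <= b by move: qab => /=; lia.
- have := bnd_dim qa; rewrite da ltnS leq_eqVlt => /orP[/eqP e|lq].
    by rewrite (bnd_uniq qa ma e) leqnn le.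
  by rewrite (eb minus) // qa orbT.
- have := bnd_dim qa; rewrite da ltnS leq_eqVlt => /orP[/eqP e|lq].
    by rewrite (bnd_uniq qa pb) ?e // leqnn le.
  by rewrite (eb plus) // qa !orbT.
Qed.

End Clamp.

(** * Freeness *)

Section Free.

Variable z : zigzag.
Local Notation I := 'I_(zlast z).+1.
Local Notation dim := (@zdim z).
Local Notation is_cell := (@is_cell (faces z)).
Local Notation trunc := (@trunc (faces z)).
Local Notation paste := (@paste (faces z)).
Local Notation composable := (@composable (faces z)).
Local Notation zbd := (@zbd z).
Implicit Types (q r g h a b m : I) (s t : sign) (x y : sign -> I -> nat).

Lemma arch_full : arch (ord0 : I) ord_max.
Proof. by split=> //; rewrite ?zdim_first ?zdim_last. Qed.

Lemma within_full q : within (ord0 : I) ord_max q.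
Proof. by rewrite /within /= -ltnS ltn_ord. Qed.

Lemma supp_full x : supp (ord0 : I) ord_max x.
Proof. by move=> s q _; exact: within_full. Qed.

Lemma supp_atom a b g : arch a b -> within a b g -> supp a b (atom g).
Proof.
move=> ab wg s q; rewrite /atom; case: eqP => [->//|_] /=.
case qg: (bnd s q g) => // _; have lt := bnd_dim qg; case: ab => le dab lo.
case/or3P: wg => [gab|ga|ga].
- have [qa|aq] := ltnP (dim q) (dim a).
    have : bnd s q a.
      rewrite -(bnd_conn s (u := g)) // => h hb.
      by apply: leq_trans qa (lo _ _); move: hb; rewrite /betw; lia.
    by rewrite /within; case: s {qg} => ->; rewrite ?orbT.
  have [sq nb] := (bndP _ _ _).1 qg; rewrite /within.
  suff -> : a <= q <= b by [].
  have out h : dim h = dim a -> ~ (betw q g h /\ h <> q :> nat).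
    move=> ha [hb hq]; have : h <> q by move=> e; apply: hq; rewrite e.
    by move=> /nb /(_ hb); rewrite ha; lia.
  have := out a erefl; have := out b (esym dab); rewrite /betw.
  by move: sq; case: s {qg nb} => /=; lia.
- by rewrite /within; move: qg; rewrite (bnd_glob s ga lt);
    case: s => ->; rewrite ?orbT.
- by rewrite /within; move: qg; rewrite (bnd_glob s ga lt);
    case: s => ->; rewrite ?orbT.
Qed.

(** The cells are generated by the atoms under composition. *)
Lemma cell_ind (P : (sign -> I -> nat) -> Prop) :
  (forall g, P (atom g)) ->
  (forall n x y, is_cell x -> is_cell y -> composable n x y ->
     P x -> P y -> P (paste n x y)) ->
  forall x, is_cell x -> P x.
Proof.
move=> Patom Ppaste.
suff gen a b : arch a b -> forall x, is_cell x -> supp a b x -> P x.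
  by move=> x cx; apply: gen arch_full _ cx (@supp_full x).
move: a b; apply: arch_ind => [a|a b m ab amb ma IH1 IH2|a b a' b' e IH] x cx sx.
- by have [g _ ->] := globe_atom cx sx.
- have [cr1|ncr1] := pselect (crosses m plus x); last first.
    apply: IH1 => //; rewrite -(not_crosses ab amb ma cx sx ncr1).
    exact: supp_clamp_left ab amb ma _ sx.
  have [cr2|ncr2] := pselect (crosses m minus x); last first.
    apply: IH2 => //; rewrite -(not_crosses ab amb ma cx sx ncr2).
    exact: supp_clamp_right ab amb ma _ sx.
  have [c12 <-] := clamp_split ab ma cx sx cr1 cr2.
  apply: Ppaste => //; try exact: clampx_cell ab amb ma cx sx.
    by apply: IH1; [exact: clampx_cell ab amb ma cx sx | exact: supp_clamp_left ab amb ma _ sx].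
  by apply: IH2; [exact: clampx_cell ab amb ma cx sx | exact: supp_clamp_right ab amb ma _ sx].
- by apply: IH => // s q /sx; rewrite e.
Qed.

Variables (D : omega_cat) (f : zglob z -> D).
Hypothesis hf : free_relations f.

Lemma oid_high k s g : dim g <= k -> oid k s (f g) = f g.
Proof.
rewrite leq_eqVlt => /orP[/eqP <-|gk]; first exact: hf.1.
have <- : oid (dim g) plus (f g) = f g by exact: hf.1.
by have [_ ->] := @omega_globular D _ _ s plus (f g) gk.
Qed.

Lemma atom_trunc k s g : exists2 g', trunc k s (atom g) = atom g' &
  oid k s (f g) = f g'.
Proof.
have [n] : exists n, dim g <= n by exists (dim g).
elim: n g => [|n IH] g gn.
  by exists g; rewrite ?trunc_atom_id ?oid_high //; lia.
have [gk|kg] := leqP (dim g) k.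
  by exists g; rewrite ?trunc_atom_id ?oid_high //; lia.
have g0 : 0 < dim g by lia.
have o1 : oid (dim g).-1 s (f g) = f (zbd s g) := hf.2 s g g0.
have [kg'|kg'] := eqVneq k (dim g).-1.
  by exists (zbd s g); rewrite kg' ?trunc_atom_bd.
have lt : k < (dim g).-1 by lia.
have [|g' h1 h2] := IH (zbd s g); first by rewrite zbd_dim; lia.
exists g'.
  by rewrite -h1 -trunc_atom_bd // trunc_trunc lt.
by rewrite -h2 -o1; have [-> _] := @omega_globular D _ _ s s (f g) lt.
Qed.

(** [F] is functorial on the cells supported by an arch and extends [f]. It is
    defined on all pairs of chains and unconstrained on the others. *)
Definition extends a b (F : (sign -> I -> nat) -> D) : Prop :=
  [/\ forall g, within a b g -> F (atom g) = f g,
      forall x k s, is_cell x -> supp a b x -> oid k s (F x) = F (trunc k s x)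
    & forall x y k, is_cell x -> is_cell y -> supp a b x -> supp a b y ->
      composable k x y -> ocomp k (F x) (F y) = Some (F (paste k x y))].

Lemma ocomp_idr k (u v : D) : v = oid k plus u -> ocomp k u v = Some u.
Proof. by move=> ->; exact: cat_idr (omega_is_cat D k) _. Qed.

Lemma ocomp_idl k (u v : D) : u = oid k minus v -> ocomp k u v = Some v.
Proof. by move=> ->; exact: cat_idl (omega_is_cat D k) _. Qed.

Lemma trivial_comp (F : (sign -> I -> nat) -> D) k x y :
  oid k plus (F x) = F (trunc k plus x) ->
  oid k minus (F y) = F (trunc k minus y) ->
  composable k x y -> trunc k minus y = y \/ trunc k plus x = x ->
  ocomp k (F x) (F y) = Some (F (paste k x y)).
Proof.
move=> ex ey xy [e|e].
  have -> : paste k x y = x by rewrite -e -[in LHS]xy paste_idr.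
  by apply: ocomp_idr; rewrite ex xy e.
have -> : paste k x y = y by rewrite -e xy paste_idl.
by apply: ocomp_idl; rewrite ey -xy e.
Qed.

(** Every cell of a globe is an atom, and its composites are trivial. *)
Lemma extends_globe a : exists F, extends a a F.
Proof.
pose F x := if pselect (exists g, x = atom g) is left h
  then f (sval (cid h)) else f a.
have FE g : F (atom g) = f g.
  rewrite /F; case: pselect => [h|no]; last by case: no; exists g.
  by congr f; apply/esym/atom_inj/(svalP (cid h)).
have Foid x k s : is_cell x -> supp a a x -> oid k s (F x) = F (trunc k s x).
  move=> cx sx; have [g _ ->] := globe_atom cx sx.
  by have [g' -> e] := atom_trunc k s g; rewrite !FE.
exists F; split=> // x y k cx cy sx sy xy.
apply: trivial_comp => //; try exact: Foid.
have [ak|ka] := leqP (dim a) k; last exact: low_identity (arch_refl a) _ _ _ _ _ _.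
by left; exact: globe_trunc cy sy ak.
Qed.

(** A cell of the arch lies to the left of [m], or to the right of [m], or is the
    composite of its two clamps; the extension is [F1], [F2] or the composite of
    their values accordingly. Composites in dimensions below [dim m] are trivial
    by [low_identity]; composites above [dim m] leave the position relative to
    [m] unchanged and are handled by the interchange law; for composites in the
    dimension of [m] the law needed is associativity. *)
Lemma extends_split a b m : arch a b -> a <= m <= b -> dim m = dim a ->
  (exists F, extends a m F) -> (exists F, extends m b F) ->
  exists F, extends a b F.
Proof.
move=> ab amb ma [F1 [at1 id1 comp1]] [F2 [at2 id2 comp2]].
set n := dim m; pose L := clampx plus m; pose R := clampx minus m.
have am := arch_left ab amb ma; have mb := arch_right ab amb ma.
have cL x : is_cell x -> supp a b x -> is_cell (L x).
  move=> cx sx; exact: clampx_cell ab amb ma cx sx.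
have cR x : is_cell x -> supp a b x -> is_cell (R x).
  move=> cx sx; exact: clampx_cell ab amb ma cx sx.
have sL x : supp a b x -> supp a m (L x) by exact: supp_clamp_left ab amb ma x.
have sR x : supp a b x -> supp m b (R x) by exact: supp_clamp_right ab amb ma x.
have agree x : is_cell x -> supp a m x -> supp m b x -> F1 x = F2 x.
  move=> cx s1 s2; have sm := supp_both ab amb ma s1 s2.
  have [g wg ->] := globe_atom cx sm; rewrite at1 ?at2 //.
    by apply: within_left_sub wg; rewrite ?leqnn //; case/andP: amb.
  by apply: (within_right_sub am _ ma) wg; case/andP: amb => -> _ /=.
pose F x := if pselect (crosses m plus x) is left _ then
    if pselect (crosses m minus x) is left _
    then odflt (F1 x) (ocomp n (F1 (L x)) (F2 (R x))) else F2 x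
  else F1 x.
have FA x : supp a m x -> F x = F1 x.
  move=> sx; rewrite /F; case: pselect => // c.
  by case: (supp_not_crosses_left ab amb ma sx).
have FB x : is_cell x -> supp m b x -> F x = F2 x.
  move=> cx sx; rewrite /F; case: pselect => [c1|nc1].
    by case: pselect => // c2; case: (supp_not_crosses_right ab amb ma sx).
  apply: agree => //.
  rewrite -(not_crosses ab amb ma cx (supp_right_sub ab amb ma sx) nc1).
  exact/sL/(supp_right_sub ab amb ma sx).
have FC x : is_cell x -> supp a b x -> crosses m plus x -> crosses m minus x ->
    ocomp n (F1 (L x)) (F2 (R x)) = Some (F x).
  move=> cx sx c1 c2; rewrite /F; do 2 case: pselect => // ?.
  have [LR xE] := clamp_split ab ma cx sx c1 c2.
  suff /(cat_defined (omega_is_cat D n)) :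
      oid n plus (F1 (L x)) = oid n minus (F2 (R x)) by case: ocomp.
  rewrite id1 ?id2; try by [exact: cL | exact: cR | exact: sL | exact: sR].
  rewrite LR; apply: agree; first exact/trunc_cell/cR.
    by rewrite -LR; exact/supp_trunc/sL.
  exact/supp_trunc/sR.
have inA x : is_cell x -> supp a b x -> ~ crosses m plus x -> supp a m x.
  by move=> cx sx nc; rewrite -(not_crosses ab amb ma cx sx nc); exact: sL.
have inB x : is_cell x -> supp a b x -> ~ crosses m minus x -> supp m b x.
  by move=> cx sx nc; rewrite -(not_crosses ab amb ma cx sx nc); exact: sR.
(* In the dimension of [m] each boundary is at most one basis element. *)
have only x s i j : is_cell x -> supp a b x -> dim i = n -> dim j = n ->
    x s i <> 0 -> x s j <> 0 -> i = j.
  move=> cx sx im jm xi xj.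
  have := level_delta ab ma cx sx im xi jm.
  by case: eqP => [->//|_ xj0]; rewrite xj0 in xj.
have Foid x k s : is_cell x -> supp a b x -> oid k s (F x) = F (trunc k s x).
  move=> cx sx; have ct := trunc_cell k s cx.
  have st : supp a b (trunc k s x) by exact: supp_trunc.
  have [c1|/(inA _ cx sx) sA] := pselect (crosses m plus x); last first.
    by rewrite !FA ?id1 //; exact: supp_trunc.
  have [c2|/(inB _ cx sx) sB] := pselect (crosses m minus x); last first.
    by rewrite !FB ?id2 //; exact: supp_trunc.
  have comp := FC x cx sx c1 c2.
  have [nk|kn] := ltnP n k.
    have tn t q : dim q = n -> trunc k s x t q = x t q.
      by move=> qn; rewrite /trunc /= qn nk.
    have c1' : crosses m plus (trunc k s x).
      by have [q [qn sq xq]] := c1; exists q; split=> //; rewrite tn.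
    have c2' : crosses m minus (trunc k s x).
      by have [q [qn sq xq]] := c2; exists q; split=> //; rewrite tn.
    have := FC _ ct st c1' c2'.
    rewrite /L /R !clampx_trunc -id1 -?id2;
      try by [exact: cL | exact: cR | exact: sL | exact: sR].
    have kn : k <> n by lia.
    have := cat_morphism_c (@omega_d_functorial D _ _ s kn) comp.
    by move=> /= -> [].
  have low : k < n -> forall t q, dim q = n -> trunc k s x t q = 0.
    by move=> lt t q qn; rewrite /trunc /= qn; case: ltngtP lt.
  (* In these cases the boundary lies to the left of [m]. *)
  have left : k < n \/ s = minus -> oid k s (F x) = F (trunc k s x).
    move=> h.
    have sA : supp a m (trunc k s x).
      apply: inA => // -[q [qn sq]]; have [/low ->//|ge] := ltnP k n.
      have kn' : k = n by lia.
      case: h => [|h]; first lia.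
      rewrite /trunc /= qn -/n kn' ltnn eqxx h => xq.
      have [i [im si xi]] := c2; have e := only x minus i q cx sx im qn xi xq.
      by move: si sq; rewrite e /=; lia.
    rewrite (FA _ sA) -(clamp_left_id ab amb ma sA) clampx_trunc.
    rewrite -id1; [|exact: cL|exact: sL].
    have [lt|ge] := ltnP k n.
      rewrite -(@omega_globular D _ _ minus s (F x) lt).1.
      rewrite (cat_source (omega_is_cat D n) comp).
      exact: (@omega_globular D _ _ minus s _ lt).1.
    have kn' : k = n by lia.
    case: h => [|->]; first lia.
    by rewrite kn' (cat_source (omega_is_cat D n) comp).
  have [lt|ge] := ltnP k n; first by apply: left; left.
  have kn' : k = n by lia.
  case: s st ct low left => st ct low left; first by apply: left; right.
  have sB : supp m b (trunc k plus x).
    apply: inB => // -[q [qn sq]].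
    rewrite /trunc /= qn -/n kn' ltnn eqxx => xq.
    have [i [im si xi]] := c1; have e := only x plus i q cx sx im qn xi xq.
    by move: si sq; rewrite e /=; lia.
  rewrite (FB _ ct sB) -(clamp_right_id ab amb ma sB) clampx_trunc.
  rewrite -id2; [|exact: cR|exact: sR].
  by rewrite kn' (cat_target (omega_is_cat D n) comp).
exists F; split=> //.
  move=> g wg.
  have [gA|gB] : within a m g \/ within m b g.
    rewrite (within_left ab amb ma) (within_right ab amb ma).
    by case: (within_cases ab amb ma wg); lia.
  - by rewrite FA ?at1 //; exact: supp_atom.
  - by rewrite FB ?at2 //; [exact: atom_cell | exact: supp_atom].
move=> x y k cx cy sx sy xy; set w := paste k x y.
have cw : is_cell w by exact: paste_cell.
have sw : supp a b w by exact: supp_paste.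
have allA : supp a m x -> supp a m y -> ocomp k (F x) (F y) = Some (F w).
  by move=> s1 s2; rewrite !FA //; [apply: comp1 | apply: supp_paste].
have allB : supp m b x -> supp m b y -> ocomp k (F x) (F y) = Some (F w).
  by move=> s1 s2; rewrite !FB //; [apply: comp2 | apply: supp_paste].
have Lw : L w = paste k (L x) (L y) by exact: clampx_paste.
have Rw : R w = paste k (R x) (R y) by exact: clampx_paste.
have Lxy : composable k (L x) (L y) by exact: clampx_composable.
have Rxy : composable k (R x) (R y) by exact: clampx_composable.
have /composableP[xy1 xy2] := xy.
case: (ltngtP k n) => kn.
- apply: trivial_comp => //; try exact: Foid.
  by apply: (low_identity ab cx cy sx sy _ xy); rewrite -ma.
- have wn t q : dim q = n -> w t q = x t q.
    by move=> qn; rewrite /w /paste /= qn kn.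
  have yn t q : dim q = n -> y t q = x t q.
    by move=> qn; rewrite xy1 //= qn.
  have [c1|nc1] := pselect (crosses m plus x); last first.
    apply: allA; apply: inA => // -[q [qn sq yq]]; apply: nc1; exists q.
    by rewrite -yn.
  have [c2|nc2] := pselect (crosses m minus x); last first.
    apply: allB; apply: inB => // -[q [qn sq yq]]; apply: nc2; exists q.
    by rewrite -yn.
  have cross t u : (forall q, dim q = n -> u t q = x t q) ->
      crosses m t x -> crosses m t u.
    by move=> e [q [qn sq xq]]; exists q; rewrite e.
  have := FC w cw sw (cross _ _ (wn plus) c1) (cross _ _ (wn minus) c2).
  rewrite Lw Rw => <-; apply: esym.
  apply: (@omega_interchange D k n); first by lia.
  + by apply: comp1; auto.
  + by apply: comp2; auto.
  + exact: FC.
  + exact: FC cy sy (cross _ _ (yn plus) c1) (cross _ _ (yn minus) c2).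
- have wplus q : dim q = n -> w plus q = y plus q.
    by move=> qn; rewrite /w /paste /= qn kn ltnn eqxx.
  have wminus q : dim q = n -> w minus q = x minus q.
    by move=> qn; rewrite /w /paste /= qn kn ltnn eqxx.
  have {xy2}xy2 q : dim q = n -> x plus q = y minus q by rewrite -kn; exact: xy2.
  have [c1|nc1] := pselect (crosses m plus y); last first.
    have sy' := inA y cy sy nc1.
    apply: allA => //; apply: inA => // -[q [qn sq]]; rewrite xy2 // => /sy'.
    by move=> /(within_left ab amb ma) /=; move: sq => /=; lia.
  have [c2|nc2] := pselect (crosses m minus x); last first.
    have sx' := inB x cx sx nc2.
    apply: allB => //; apply: inB => // -[q [qn sq]]; rewrite -xy2 // => /sx'.
    by move=> /(within_right ab amb ma) /=; move: sq => /=; lia.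
  have c1w : crosses m plus w.
    by have [q [qn sq yq]] := c1; exists q; rewrite wplus.
  have c2w : crosses m minus w.
    by have [q [qn sq xq]] := c2; exists q; rewrite wminus.
  have Fw := FC w cw sw c1w c2w; rewrite Lw Rw in Fw.
  (* The left part of a cell to the right of [m] is an identity. *)
  have LwB : supp m b y -> paste k (L x) (L y) = L x.
    move=> sy'.
    have e : trunc k minus (L y) = L y.
      apply: (globe_trunc (a := m)); [exact: cL | | by rewrite kn].
      by apply: supp_clamp_left mb _ _ _ sy'; rewrite // leqnn; case/andP: amb.
    by rewrite -[L y]e -[trunc _ _ _]Lxy paste_idr.
  have RwA : supp a m x -> paste k (R x) (R y) = R y.
    move=> sx'.
    have e : trunc k plus (R x) = R x.
      apply: (globe_trunc (a := m)); [exact: cR | | by rewrite kn].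
      by apply: supp_clamp_right am _ _ _ sx'; rewrite // leqnn andbT; case/andP: amb.
    by rewrite -[R x]e [trunc _ _ _]Rxy paste_idl.
  rewrite kn in Fw LwB RwA Lxy Rxy *.
  have [c3|nc3] := pselect (crosses m plus x).
    have nc4 : ~ crosses m minus y.
      move=> [i [im si yi]]; have [j [jm sj xj]] := c3.
      rewrite xy2 // in xj; have e := only y minus i j cy sy im jm yi xj.
      by move: si sj; rewrite e /=; lia.
    have sy' := inB y cy sy nc4.
    rewrite (FB y) // -Fw LwB //.
    have Ry : R y = y by exact: clamp_right_id ab amb ma _ sy'.
    apply: (cat_assoc (omega_is_cat D n)); first exact: FC.
    by rewrite -[in F2 y]Ry; apply: comp2; auto.
  have sx' := inA x cx sx nc3; rewrite (FA x) //.
  have Lx : L x = x by exact: clamp_left_id ab amb ma _ sx'.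
  have [c4|nc4] := pselect (crosses m minus y).
    rewrite -Fw RwA //; apply: esym.
    apply: (cat_assoc (omega_is_cat D n)); last exact: FC.
    by rewrite -[in F1 x]Lx; apply: comp1; auto.
  have sy' := inB y cy sy nc4; rewrite (FB y) //.
  have Ry : R y = y by exact: clamp_right_id ab amb ma _ sy'.
  by rewrite -Fw LwB // RwA // Lx Ry.
Qed.

Lemma extends_exists : exists F, extends ord0 ord_max F.
Proof.
apply: (arch_ind (Q := fun a b => exists F, extends a b F)) arch_full.
- exact: extends_globe.
- by move=> a b m; exact: extends_split.
- move=> a b a' b' e [F [atF idF compF]].
  have sub x : supp a b x -> supp a' b' x by move=> sx s q /sx; rewrite e.
  exists F; split=> [g|x k s cx /sub sx|x y k cx cy /sub sx /sub sy].
  + by rewrite e; exact: atF.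
  + exact: idF.
  + exact: compF.
Qed.

End Free.

Section CellsFree.

Variable z : zigzag.

Definition zcells : omega_cat := cells (faces z).

Definition zatom (g : zglob z) : zcells := exist _ (atom g) (atom_cell g).

Lemma zatom_relations : free_relations zatom.
Proof.
split=> [s g|s g g0]; apply: cell_type_eq => /=.
  exact: trunc_atom_id.
exact: trunc_atom_bd.
Qed.

Lemma zcells_ext (D : omega_cat) (F H : omega_functor zcells D) :
  (forall g, F (zatom g) = H (zatom g)) -> F = H.
Proof.
move=> FH; apply: omega_functor_eq; apply/funext => -[x cx].
pose P x := forall cx : is_cell x,
  F (exist _ x cx : zcells) = H (exist _ x cx : zcells).
apply: (cell_ind (P := P)) (cx) => // [g|n u v cu cv uv Pu Pv] {}cx.
  have -> : (exist _ (atom g) cx : zcells) = zatom g.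
    exact: (cell_type_eq (I := faces z)).
  exact: FH.
have e : ocomp n (exist _ u cu : zcells) (exist _ v cv) =
    Some (exist _ (paste (I := faces z) n u v) cx).
  exact/cell_compP.
have := cat_morphism_c (omega_funP F n) e.
by rewrite Pu Pv (cat_morphism_c (omega_funP H n) e) => -[].
Qed.

(** The whole zigzag is an arch, which supports every cell. *)
Lemma zcells_free : is_free_omega_cat (zglob z) zcells.
Proof.
exists zatom; split; first exact: zatom_relations.
move=> D f hf; have [F [atF idF compF]] := extends_exists hf.
have Fmor n : is_cat_morphism (@oid zcells n) (@ocomp zcells n)
    (@oid D n) (@ocomp D n) (fun x : zcells => F (sval x)).
  split=> [s x|x y w /cell_compP[xy <-]].
    by rewrite idF //; [exact: (svalP x) | exact: supp_full].
  by apply: compF => //; try exact: supp_full; exact: svalP.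
pose FF : omega_functor zcells D := OmegaFunctor Fmor.
have FFE g : FF (zatom g) = f g by apply: atF; exact: within_full.
exists FF; split=> // H HE; apply: zcells_ext => g.
by rewrite FFE HE.
Qed.

Lemma zcells_simple : simple_omega_cat zcells.
Proof. by exists (zglob z); split; [exact: zglob_simple | exact: zcells_free]. Qed.

End CellsFree.

(** * Coordinates in disc complexes *)

Definition disc_zigzag (C : disc_complex) : zigzag :=
  Zigzag (@ddim_first C) (@ddim_last C) (@ddim_step C).

Definition disc_faces (C : disc_complex) : incidence := faces (disc_zigzag C).

Lemma sum_bindex (R : nmodType) p (dim : 'I_p.+1 -> nat) n (F : 'I_p.+1 -> R) :
  (\sum_(q : bindex dim n) F (val q) = \sum_(q | dim q == n) F q)%R.
Proof. by rewrite -(big_sub (fun q => dim q == n)). Qed.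

Section Coordinates.

Variable C : disc_complex.
Local Notation dim := (@ddim C).
Local Notation I := 'I_(dlast C).+1.
Local Open Scope ring_scope.

Definition coords n (x : C n) : {ffun bindex dim n -> int} :=
  sval (cid (dbasisP x)).

Lemma coordsE n (x : C n) : x = \sum_q dbasis q *~ coords x q.
Proof. by have [] := svalP (cid (dbasisP x)). Qed.

Lemma coords_uniq n (x : C n) (a : {ffun bindex dim n -> int}) :
  x = \sum_q dbasis q *~ a q -> coords x = a.
Proof. by have [_] := svalP (cid (dbasisP x)); apply. Qed.

(** Coordinates indexed by all basis elements, zero outside dimension [n]; this
    form makes sums independent of the dependent type [bindex]. *)
Definition co n (x : C n) (r : I) : int :=
  if insub r is Some r' then coords x r' else 0.

Lemma co_val n (x : C n) (q : bindex dim n) : co x (val q) = coords x q.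
Proof. by rewrite /co valK. Qed.

Lemma co_out n (x : C n) (r : I) : dim r <> n -> co x r = 0.
Proof. by move=> rn; rewrite /co insubN //; apply/eqP. Qed.

Lemma coE n (x : C n) : x = \sum_(q : bindex dim n) dbasis q *~ co x (val q).
Proof. by rewrite {1}(coordsE x); apply: eq_bigr => q _; rewrite co_val. Qed.

Lemma co_ext n (x y : C n) : (forall r, dim r = n -> co x r = co y r) -> x = y.
Proof.
move=> e; rewrite (coE x) (coE y); apply: eq_bigr => q _; rewrite e //.
by case: q => q /= /eqP.
Qed.

Lemma co_lin n (a : {ffun bindex dim n -> int}) q :
  co (\sum_q' dbasis q' *~ a q') (val q) = a q.
Proof. by rewrite co_val (coords_uniq (a := a)). Qed.

Lemma bindex_cases n (P : I -> Prop) : (forall r, dim r <> n -> P r) ->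
  (forall q : bindex dim n, P (val q)) -> forall r, P r.
Proof.
move=> out inn r; have [rn|/eqP] := eqVneq (dim r) n; last exact: out.
by have := inn (exist _ r (introT eqP rn)).
Qed.

Lemma coD n (x y : C n) r : co (x + y) r = co x r + co y r.
Proof.
move: r; apply: (@bindex_cases n) => [r rn|q]; first by rewrite !co_out // addr0.
rewrite {1}(coE x) {1}(coE y) -big_split /=.
rewrite (eq_bigr (fun q => dbasis q *~
    [ffun q => co x (val q) + co y (val q)] q)); last first.
  by move=> q' _; rewrite ffunE mulrzDr.
by rewrite co_lin ffunE.
Qed.

Lemma co0 n r : co (0 : C n) r = 0.
Proof. by apply: (addrI (co (0 : C n) r)); rewrite -coD !addr0. Qed.

Lemma coN n (x : C n) r : co (- x) r = - co x r.
Proof. by apply: (addrI (co x r)); rewrite -coD !subrr co0. Qed.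

Lemma co_sum n (T : Type) (s : seq T) (P : pred T) (F : T -> C n) r :
  co (\sum_(i <- s | P i) F i) r = \sum_(i <- s | P i) co (F i) r.
Proof. by apply: (big_morph (fun x => co x r)) => [x y|]; rewrite ?coD ?co0. Qed.

Lemma coMz n (x : C n) (k : int) r : co (x *~ k) r = co x r * k.
Proof.
have coMn (j : nat) : co (x *+ j) r = co x r * j%:Z.
  elim: j => [|j IH]; first by rewrite mulr0n co0 mulr0.
  by rewrite mulrS coD IH intS mulrDr mulr1.
case: k => [j|j]; first exact: coMn.
by rewrite NegzE mulrNz coN coMn mulrN.
Qed.

Lemma co_basis n (q : bindex dim n) r : co (dbasis q) r = (r == val q)%:Z.
Proof.
move: r; apply: (@bindex_cases n) => [r rn|q'].
  rewrite co_out //; case: eqP => // e; case: rn; rewrite e.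
  by case: q {e} => q /= /eqP.
have -> : dbasis q = \sum_q' dbasis q' *~ [ffun q' => (q' == q)%:Z] q'.
  rewrite (bigD1 q) //= ffunE eqxx mulr1z big1 ?addr0 // => q0 /negbTE h.
  by rewrite ffunE h mulr0z.
by rewrite co_lin ffunE.
Qed.

Lemma dim_val n (q : bindex dim n) : dim (val q) = n.
Proof. by case: q => q /= /eqP. Qed.

Lemma sum_deltaz (P : pred I) (F : I -> int) r :
  \sum_(q | P q) F q * (r == q)%:Z = if P r then F r else 0.
Proof.
rewrite big_mkcond (bigD1 r) //= eqxx mulr1 big1 ?addr0 //.
by move=> q /negbTE qr; rewrite eq_sym qr mulr0; case: ifP.
Qed.

(** The coboundary is the transpose of the boundary of the zigzag. *)
Lemma co_cobd n (x : C n) (r : I) : dim r = n.+1 ->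
  co (cobd C n x) r = \sum_(q | dim q == n) co x q *
    ((@iface (disc_faces C) plus q r)%:Z - (@iface (disc_faces C) minus q r)%:Z).
Proof.
move=> rn; rewrite -sum_bindex {1}(coE x) raddf_sum co_sum.
apply: eq_bigr => q _; rewrite raddfMz coMz mulrC dcobdE; congr (_ * _).
have E (P : pred I) : co (\sum_(r' : bindex dim n.+1 | P (val r')) dbasis r') r
    = (P r)%:Z.
  rewrite co_sum (eq_bigr (fun r' => 1 * (r == val r')%:Z)); last first.
    by move=> r' _; rewrite co_basis mul1r.
  rewrite big_mkcond (@sum_bindex _ _ dim n.+1 (fun q => if P q then
    1 * (r == q)%:Z else 0)) -big_mkcondr sum_deltaz rn eqxx /=.
  by case: (P r).
by rewrite coD coN (E (in_delta_plus dim (val q))) (E (in_delta_minus dim (val q)))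
   /= /face /= rn dim_val eqxx.
Qed.

Lemma co_coaug r : co (coaug C 1) r = (dim r == 0%N)%:Z.
Proof.
rewrite dcoaugE co_sum (eq_bigr (fun r' => 1 * (r == val r')%:Z)); last first.
  by move=> r' _; rewrite co_basis mul1r.
rewrite (@sum_bindex _ _ dim 0 (fun q => 1 * (r == q)%:Z)) sum_deltaz.
by case: ifP.
Qed.

Lemma basis_sumP n (x : C n) : is_basis_sum x <-> forall r, 0 <= co x r.
Proof.
split=> [[s ->] r|x0].
  by rewrite co_sum Num.Theory.sumr_ge0 // => q _; rewrite co_basis; case: eqP.
exists (flatten [seq nseq `|co x (val q)|%N q | q <- index_enum (bindex dim n)]).
rewrite {1}(coE x) big_flatten big_map; apply: eq_bigr => q _.
rewrite big_nseq -[in LHS](gez0_abs (x0 (val q))) -pmulrn.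
by elim: `|_|%N => //= k <-; rewrite mulrS.
Qed.

Lemma basis_is_sum n (q : bindex dim n) : is_basis_sum (dbasis q).
Proof. by apply/basis_sumP => r; rewrite co_basis; case: eqP. Qed.

End Coordinates.

(** * Maps of disc complexes and matrices *)

Lemma sum_diffz (J : finType) (K P Q : pred J) (F : J -> nat) :
  (forall j, P j -> K j) -> (forall j, Q j -> K j) ->
  (\sum_(j | K j) (F j)%:Z * ((P j)%:Z - (Q j)%:Z) =
   (\sum_(j | P j) F j)%N%:Z - (\sum_(j | Q j) F j)%N%:Z)%R.
Proof.
move=> PK QK.
have E (X : pred J) : (forall j, X j -> K j) ->
    ((\sum_(j | X j) F j)%N%:Z = \sum_(j | K j) (F j)%:Z * (X j)%:Z)%R.
  move=> XK; rewrite (big_morph Posz PoszD (erefl _)) [LHS]big_mkcond.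
  rewrite [RHS]big_mkcond; apply: eq_bigr => j _.
  have := XK j; case: (X j) => [->//|_]; first by rewrite mulr1.
  by rewrite mulr0; case: ifP.
rewrite !E // -sumrB; apply: eq_bigr => j _; exact: mulrBr.
Qed.

Section DiscMatrix.

Variables C D : disc_complex.
Local Open Scope ring_scope.

Definition disc_base (q : disc_faces C) : C (ddim q) :=
  dbasis (exist _ q (eqxx (ddim q))).

Lemma co_cobd_base (q r : disc_faces C) : ddim r = (ddim q).+1 ->
  co (cobd C _ (disc_base q)) r =
  (iface plus q r)%:Z - (iface minus q r)%:Z.
Proof.
move=> rq; rewrite co_cobd // (eq_bigr (fun q' : disc_faces C =>
   ((iface plus q' r)%:Z - (iface minus q' r)%:Z) * (q == q')%:Z)); last first.
  by move=> q' _; rewrite co_basis mulrC eq_sym.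
by rewrite sum_deltaz eqxx.
Qed.

Variable phi : disc_map C D.

(** The transposed matrix: a map of complexes from [C] to [D] acts on cells from
    the zigzag of [D] to that of [C]. The coordinates are nonnegative by
    [basis_sumP], so taking absolute values loses nothing. *)
Definition disc_mx (r : disc_faces D) (q : disc_faces C) : nat :=
  `|co (phi _ (disc_base q)) r|%N.

Lemma disc_mxE n (q : bindex (@ddim C) n) r :
  co (phi n (dbasis q)) r = (disc_mx r (val q))%:Z.
Proof.
case: q => q e; move: (eqP e) => e'; subst n.
rewrite (eq_irrelevance e (eqxx _)) /disc_mx gez0_abs //.
by move: r; apply/basis_sumP/dmap_sum/basis_is_sum.
Qed.

Lemma co_dmap n (x : C n) r :
  co (phi n x) r = \sum_(q | ddim q == n) co x q * (disc_mx r q)%:Z.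
Proof.
rewrite -(sum_bindex (@ddim C) n (fun q => co x q * (disc_mx r q)%:Z)) {1}(coE x).
rewrite raddf_sum co_sum; apply: eq_bigr => q _.
by rewrite raddfMz coMz disc_mxE mulrC.
Qed.

Lemma disc_mx_graded : graded_matrix disc_mx.
Proof. by move=> r q rq; rewrite /disc_mx co_out. Qed.

Lemma disc_mx_chain : chain_matrix disc_mx.
Proof.
split=> [|r]; first exact: disc_mx_graded.
apply: chain_at_graded => [|r0|q rq]; first exact: disc_mx_graded.
  have := congr1 (fun u => co u r) (dmap_coaug phi 1).
  rewrite co_dmap co_coaug (r0 : ddim r = 0%N) eqxx.
  rewrite (eq_bigr (fun q => (disc_mx r q)%:Z)); last first.
    by move=> q q0; rewrite co_coaug q0 mul1r.
  by rewrite -(big_morph Posz PoszD (erefl _)) => -[].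
have := congr1 (fun u => co u r) (dmap_cobd phi (disc_base q)).
rewrite co_dmap co_cobd //.
rewrite (eq_bigr (fun q' : disc_faces C => (disc_mx r q')%:Z *
    ((iface plus q q')%:Z - (iface minus q q')%:Z))); last first.
  by move=> q' /eqP q'q; rewrite co_cobd_base // mulrC.
rewrite [RHS](eq_bigr (fun h : disc_faces D => (disc_mx h q)%:Z *
    ((iface plus h r)%:Z - (iface minus h r)%:Z))); last first.
  by move=> h _; rewrite disc_mxE.
rewrite !sum_diffz; first by lia.
- by move=> h /iface_dim /= e; apply/eqP; move: rq => /=; lia.
- by move=> h /iface_dim /= e; apply/eqP; move: rq => /=; lia.
- by move=> h /iface_dim /= ->.
- by move=> h /iface_dim /= ->.
Qed.

End DiscMatrix.

Lemma disc_mx_inj C D (phi psi : disc_map C D) :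
  (forall r q, ddim r = ddim q -> disc_mx phi r q = disc_mx psi r q) ->
  phi = psi.
Proof.
move=> e; apply: disc_map_eq => n x; apply: co_ext => r rn.
rewrite !co_dmap; apply: eq_bigr => q /eqP qn; rewrite e //.
by rewrite rn qn.
Qed.

Section MatrixMap.

Variables (C D : disc_complex) (M : disc_faces D -> disc_faces C -> nat).
Hypothesis chM : chain_matrix M.
Local Open Scope ring_scope.

Definition mx_fun n (x : C n) : D n :=
  \sum_(r : bindex (@ddim D) n)
    dbasis r *~ \sum_(q | ddim q == n) co x q * (M (val r) q)%:Z.

Lemma co_mx_fun n (x : C n) r : ddim r = n ->
  co (mx_fun x) r = \sum_(q | ddim q == n) co x q * (M r q)%:Z.
Proof.
move: r; apply: (@bindex_cases D n) => [//|r _].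
rewrite /mx_fun (eq_bigr (fun r' => dbasis r' *~ [ffun r' : bindex (@ddim D) n =>
  \sum_(q | ddim q == n) co x q * (M (val r') q)%:Z] r')).
  by rewrite co_lin ffunE.
by move=> r' _; rewrite ffunE.
Qed.

Lemma mx_fun_additive n : zmod_morphism (@mx_fun n).
Proof.
move=> x y; apply: co_ext => r rn; rewrite coD coN !co_mx_fun // -sumrB.
by apply: eq_bigr => q _; rewrite coD coN mulrBl.
Qed.

HB.instance Definition _ n :=
  GRing.isZmodMorphism.Build (C n) (D n) (@mx_fun n) (@mx_fun_additive n).

Lemma mx_fun_cobd n (x : C n) : mx_fun (cobd C n x) = cobd D n (mx_fun x).
Proof.
apply: co_ext => r rn; rewrite co_mx_fun // co_cobd //.
have L : \sum_(q' | ddim q' == n.+1) co (cobd C n x) q' * (M r q')%:Z =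
    \sum_(q | ddim q == n) co x q *
     \sum_(q' | ddim q' == n.+1) (M r q')%:Z *
      ((@iface (disc_faces C) plus q q')%:Z - (@iface (disc_faces C) minus q q')%:Z).
  under eq_bigr => q' q'n do rewrite co_cobd ?(eqP q'n) // mulr_suml.
  rewrite exchange_big; apply: eq_bigr => q _; rewrite mulr_sumr.
  by apply: eq_bigr => q' _; rewrite -mulrA [in LHS](mulrC _ (M _ _)%:Z).
have R : \sum_(r' | ddim r' == n) co (mx_fun x) r' *
      ((@iface (disc_faces D) plus r' r)%:Z - (@iface (disc_faces D) minus r' r)%:Z) =
    \sum_(q | ddim q == n) co x q *
     \sum_(r' | ddim r' == n) (M r' q)%:Z *
      ((@iface (disc_faces D) plus r' r)%:Z - (@iface (disc_faces D) minus r' r)%:Z).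
  under eq_bigr => r' r'n do rewrite co_mx_fun ?(eqP r'n) // mulr_suml.
  rewrite exchange_big; apply: eq_bigr => q _; rewrite mulr_sumr.
  by apply: eq_bigr => r' _; rewrite mulrA.
rewrite L R; apply: eq_bigr => q /eqP qn; congr (_ * _).
rewrite !sum_diffz.
- have arith (a b c d : nat) : (a + d = b + c)%N -> a%:Z - b%:Z = c%:Z - d%:Z.
    by lia.
  exact: arith ((chM.2 r).2 q).
- by move=> h /iface_dim /= e; apply/eqP; lia.
- by move=> h /iface_dim /= e; apply/eqP; lia.
- by move=> h /iface_dim /= ->; rewrite qn.
- by move=> h /iface_dim /= ->; rewrite qn.
Qed.

Lemma mx_fun_coaug k : mx_fun (coaug C k) = coaug D k.
Proof.
rewrite -[k]intz !raddfMz; congr (_ *~ _).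
apply: co_ext => r r0; rewrite co_mx_fun // co_coaug r0 eqxx.
rewrite (eq_bigr (fun q => (M r q)%:Z)).
  by rewrite -(big_morph Posz PoszD (erefl _)) (chM.2 r).1.
by move=> q q0; rewrite co_coaug q0 mul1r.
Qed.

Lemma mx_fun_sum n (x : C n) : is_basis_sum x -> is_basis_sum (mx_fun x).
Proof.
move=> /basis_sumP x0; apply/basis_sumP => r.
have [rn|/eqP rn] := eqVneq (ddim r) n; last by rewrite co_out.
by rewrite co_mx_fun // Num.Theory.sumr_ge0 // => q _; rewrite Num.Theory.mulr_ge0.
Qed.

Definition mx_map : disc_map C D :=
  @DiscMap C D (fun n => @mx_fun n) mx_fun_cobd mx_fun_coaug mx_fun_sum.

Lemma mx_mapK r q : ddim r = ddim q -> disc_mx mx_map r q = M r q.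
Proof.
move=> rq; rewrite /disc_mx /= co_mx_fun //.
rewrite (eq_bigr (fun q' => (M r q')%:Z * (q == q')%:Z)); last first.
  by move=> q' _; rewrite co_basis mulrC eq_sym.
by rewrite sum_deltaz eqxx.
Qed.

End MatrixMap.

(** * The functor from disc complexes to the opposite of Theta *)

Definition disc_theta (C : disc_complex) : opposite Theta :=
  exist _ (zcells (disc_zigzag C)) (zcells_simple (disc_zigzag C)).

Definition disc_functor_map (C D : disc_complexes) (phi : hom C D) :
  @hom (opposite Theta) (disc_theta C) (disc_theta D) :=
  push_functor (disc_mx_chain phi).

Lemma push_id C x : push (disc_mx (disc_id C)) x = x.
Proof.
apply: (chain_eq (I := disc_faces C)) => s q.
have E g : disc_mx (disc_id C) g q = (g == q :> disc_faces C).
  by rewrite /disc_mx /= co_basis; case: eqP.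
rewrite /push (bigD1 q) //= E eqxx muln1 big1 ?addn0 // => g /negbTE gq.
by rewrite E gq muln0.
Qed.

Lemma push_comp (C D E : disc_complex) (psi : disc_map D E) (phi : disc_map C D) x :
  push (disc_mx (disc_comp psi phi)) x = push (disc_mx phi) (push (disc_mx psi) x).
Proof.
apply: (chain_eq (I := disc_faces C)) => s q; rewrite /push.
have K r : disc_mx (disc_comp psi phi) r q =
    \sum_(d : disc_faces D) disc_mx psi r d * disc_mx phi d q.
  apply/eqP; rewrite -eqz_nat; apply/eqP.
  rewrite -[LHS](disc_mxE (disc_comp psi phi) (exist _ q (eqxx (ddim q)))).
  rewrite /= co_dmap (big_morph Posz PoszD (erefl _)) big_mkcond.
  apply: eq_bigr => d _ /=; case: eqP => dq; last first.
    by rewrite [X in _ * X]disc_mx_graded ?muln0.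
  by rewrite disc_mxE PoszM mulrC.
under eq_bigr do rewrite K big_distrr.
rewrite exchange_big; apply: eq_bigr => d _; rewrite big_distrl.
by apply: eq_bigr => r _ /=; rewrite mulnA.
Qed.

Lemma disc_functor_id (C : disc_complexes) :
  disc_functor_map (idm C) = idm (disc_theta C).
Proof.
apply: omega_functor_eq; apply/funext => x.
by apply: (cell_type_eq (I := disc_faces C)); exact: push_id.
Qed.

Lemma disc_functor_comp (C D E : disc_complexes) (psi : hom D E) (phi : hom C D) :
  disc_functor_map (comp psi phi) =
  comp (disc_functor_map psi) (disc_functor_map phi).
Proof.
apply: omega_functor_eq; apply/funext => x.
by apply: (cell_type_eq (I := disc_faces C)); exact: push_comp.
Qed.

Definition disc_functor : functor disc_complexes (opposite Theta) :=
  @Functor disc_complexes (opposite Theta) disc_theta disc_functor_map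
    disc_functor_id disc_functor_comp.

Lemma push_atom (z w : zigzag) (M : faces z -> faces w -> nat) s r q :
  graded_matrix M -> zdim r = zdim q -> push M (atom r) s q = M r q.
Proof.
move=> Mgr rq; rewrite /push (bigD1 r) //= {1}/atom eqxx mul1n big1 ?addn0 //.
move=> g gr; have [gq|/eqP gq] := eqVneq (zdim g) (zdim q); last by rewrite Mgr ?muln0.
rewrite /atom (negbTE gr) /=; case: (boolP (bnd s g r)) => // /bnd_dim; lia.
Qed.

Lemma disc_functor_faithful (C D : disc_complexes) (phi psi : hom C D) :
  fmap disc_functor phi = fmap disc_functor psi -> phi = psi.
Proof.
move=> e; apply: disc_mx_inj => r q rq.
have := congr1 (fun F : omega_functor (zcells (disc_zigzag D)) (zcells (disc_zigzag C))
  => sval (F (@zatom (disc_zigzag D) r)) plus q) e.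
by rewrite /= !push_atom //; exact: disc_mx_graded.
Qed.

(** * Fullness *)

Lemma trunc_atom (z : zigzag) k s (r : 'I_(zlast z).+1) : k <= zdim r ->
  exists2 g, zdim g = k & trunc (I := faces z) k s (atom r) = atom g.
Proof.
have [n] : exists n, zdim r <= n by exists (zdim r).
elim: n r => [|n IH] r rn kr.
  by exists r; [lia | rewrite trunc_atom_id //; lia].
have [e|ne] := eqVneq k (zdim r); first by exists r; rewrite ?trunc_atom_id // e.
have r0 : 0 < zdim r by lia.
have [e|ne'] := eqVneq k (zdim r).-1.
  by exists (zbd s r); rewrite ?zbd_dim // e trunc_atom_bd.
have [||g gk e] := IH (zbd s r); rewrite ?zbd_dim //; try lia.
exists g; rewrite // -e -trunc_atom_bd // trunc_trunc.
by have -> : k < (zdim r).-1 by lia.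
Qed.

(** Row [r] of the matrix is the top chain of the image of the atom of [r]. The
    image of an atom is a cell of dimension at most [zdim r] whose lower chains
    are the top chains of images of faces, so the boundary equation of this cell
    says that the matrix is a chain map. Both functors agree on atoms, hence
    everywhere. *)
Lemma functor_matrix (z w : zigzag) (H : omega_functor (zcells z) (zcells w)) :
  exists M (chM : chain_matrix M), push_functor chM = H.
Proof.
pose h r := sval (H (zatom r)).
have hcell r : is_cell (h r) := svalP (H (zatom r)).
have htrunc k s (r g : faces z) :
    trunc (I := faces z) k s (atom r) = atom g -> trunc (I := faces w) k s (h r) = h g.
  move=> e; have eg : oid k s (zatom r) = zatom g.
    exact: (cell_type_eq (I := faces z)).
  have := cat_morphism_d (omega_funP H k) s (zatom r).
  by rewrite eg /h => ->.
have hid n s r : zdim r <= n -> trunc (I := faces w) n s (h r) = h r.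
  by move=> rn; apply: htrunc; exact: trunc_atom_id.
have hhigh s (r : faces z) (q : faces w) : zdim r < zdim q -> h r s q = 0.
  move=> rq; rewrite -(hid (zdim r) s r (leqnn _)) /trunc /=.
  by case: ltngtP rq.
have hpm s t (r : faces z) (q : faces w) : zdim q = zdim r -> h r s q = h r t q.
  move=> qr; rewrite -{1}(hid (zdim r) t r (leqnn _)) /trunc /=.
  by rewrite qr ltnn eqxx.
pose M (r : faces z) (q : faces w) := if zdim q == zdim r then h r plus q else 0.
have hM s (r : faces z) (q : faces w) : zdim q = zdim r -> h r s q = M r q.
  by move=> qr; rewrite /M qr eqxx; exact: hpm.
have Mgr : graded_matrix M.
  by move=> r q rq; rewrite /M; case: eqP => // e; case: rq; rewrite /= e.
have chM : chain_matrix M.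
  split=> // r; apply: chain_at_graded => // [r0|q rq].
    rewrite -((hcell r).1 plus); apply: eq_bigr => q /eqP q0.
    by rewrite (hM plus) //; move: r0 q0 => /= -> ->.
  have A b : \sum_(q' | iface b q q') M r q' = \sum_(q' | iface b q q') h r plus q'.
    apply: eq_bigr => q' /iface_dim q'q; rewrite (hM plus) //.
    by move: rq q'q => /= -> ->.
  have r0 : 0 < zdim r by move: rq => /= ->.
  have B b : \sum_(k | iface b k r) M k q = h r b q.
    rewrite (@sum_face z b r (fun k => M k q)) r0.
    have <- := hM b (zbd b r) q _; last by rewrite zbd_dim // -[zdim r]/(idim r) rq.
    rewrite -(htrunc _ _ _ _ (trunc_atom_bd b r0)) /trunc /=.
    by rewrite -[zdim r]/(idim r) rq /= ltnn eqxx.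
  by rewrite !A !B; exact: (hcell r).2.
exists M, chM; apply: zcells_ext => r; apply: (cell_type_eq (I := faces w)).
apply: (chain_eq (I := faces w)) => s q; rewrite /= -/(h r) /push.
have [rq|qr] := ltnP (zdim r) (zdim q).
  rewrite hhigh // big1 // => g _; have [gq|/eqP gq] := eqVneq (zdim g) (zdim q).
    rewrite /atom; case: eqP => [e|_]; first by move: rq; rewrite -gq e ltnn.
    by case: (boolP (bnd s g r)) => // /bnd_dim; lia.
  by rewrite Mgr ?muln0.
have [g' g'q e] := trunc_atom s qr.
have at' g : zdim g = zdim q -> atom r s g = (g == g').
  move=> gq; have := congr1 (fun x => x s g) e; rewrite /trunc /= gq ltnn eqxx => ->.
  rewrite /atom; case: (g == g') => //=.
  by case: (boolP (bnd s g g')) => // /bnd_dim; lia.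
rewrite (bigD1 g') //= at' // eqxx mul1n big1 ?addn0; last first.
  move=> g /negbTE gg'; have [gq|/eqP gq] := eqVneq (zdim g) (zdim q).
    by rewrite at' // gg'.
  by rewrite Mgr ?muln0.
rewrite -(hM s) // -(htrunc _ _ _ _ e) /trunc /= ltnn eqxx //.
Qed.

Lemma disc_functor_full (C D : disc_complexes)
    (H : hom (disc_functor C) (disc_functor D)) :
  exists phi : hom C D, fmap disc_functor phi = H.
Proof.
have [M [chM <-]] := functor_matrix (H : omega_functor (zcells _) (zcells _)).
exists (mx_map (chM : chain_matrix (M : disc_faces D -> disc_faces C -> nat))).
apply: omega_functor_eq; apply/funext => x.
apply: (cell_type_eq (I := disc_faces C)).
congr (push _ (sval x)); apply/funext => r; apply/funext => q.
have [rq|/eqP rq] := eqVneq (ddim r) (ddim q); first exact: mx_mapK.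
by rewrite disc_mx_graded // (chM.1 r q).
Qed.

(** * Essential surjectivity *)

(** The complex of a zigzag is the dual of its chain complex: a cochain is a
    function on basis elements, and its coboundary is the difference of its
    values at the two faces. *)
Section DiscOf.

Variable z : zigzag.
Local Notation dim := (@zdim z).
Local Open Scope ring_scope.

Definition zcochain n : zmodType := {ffun bindex dim n -> int}.

Lemma zbd_bindex n s (r : bindex dim n.+1) : dim (zbd s (val r)) == n.
Proof.
by case: r => r /= /eqP rn; rewrite zbd_dim rn.
Qed.

Definition ibd n s (r : bindex dim n.+1) : bindex dim n :=
  exist _ (zbd s (val r)) (zbd_bindex s r).

Definition zcobd n (x : zcochain n) : zcochain n.+1 :=
  [ffun r => x (ibd plus r) - x (ibd minus r)].

Lemma zcobd_additive n : zmod_morphism (@zcobd n).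
Proof. by move=> x y; apply/ffunP => r; rewrite !ffunE !opprD !opprK addrACA. Qed.

HB.instance Definition _ n :=
  GRing.isZmodMorphism.Build (zcochain n) (zcochain n.+1) (@zcobd n)
    (@zcobd_additive n).

Definition zcoaug (k : int) : zcochain 0 := [ffun=> k].

Lemma zcoaug_additive : zmod_morphism zcoaug.
Proof. by move=> x y; apply/ffunP => r; rewrite !ffunE. Qed.

HB.instance Definition _ :=
  GRing.isZmodMorphism.Build int (zcochain 0) zcoaug zcoaug_additive.

Lemma zcobd_cobd n (x : zcochain n) : zcobd (zcobd x) = 0.
Proof.
apply/ffunP => r; rewrite !ffunE.
have e s : ibd s (ibd minus r) = ibd s (ibd plus r).
  apply: val_inj => /=; apply: zbd_bd.
  by case: r => r /= /eqP ->.
by rewrite !e subrr.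
Qed.

Lemma zcobd_coaug k : zcobd (zcoaug k) = 0.
Proof. by apply/ffunP => r; rewrite !ffunE subrr. Qed.

Definition zcomplex : coaug_complex :=
  @CoaugComplex zcochain (fun n => @zcobd n) zcoaug zcobd_cobd zcobd_coaug.

Definition zbasis n (q : bindex dim n) : zcomplex n := [ffun q' => (q' == q)%:Z].

Lemma zbasis_sum n (a : bindex dim n -> int) q :
  (\sum_q' zbasis q' *~ a q' : zcochain n) q = a q.
Proof.
rewrite sum_ffunE (bigD1 q) //= big1 ?addr0 => [|q' /negbTE q'q].
  by rewrite ffunMzE ffunE eqxx intz.
by rewrite ffunMzE ffunE eq_sym q'q mul0rz.
Qed.

Lemma zbasisP : is_graded_basis zbasis.
Proof.
move=> n x; exists x; split=> [|a ->]; first by apply/ffunP => q; rewrite zbasis_sum.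
by apply/ffunP => q; rewrite zbasis_sum.
Qed.

Lemma zbasis_pick n (P : pred (bindex dim n)) q :
  (\sum_(q' | P q') zbasis q' : zcochain n) q = (P q)%:Z.
Proof.
rewrite sum_ffunE big_mkcond (bigD1 q) //= big1 ?addr0 => [|q' /negbTE q'q].
  by rewrite ffunE eqxx; case: (P q).
by rewrite ffunE eq_sym q'q; case: (P q').
Qed.

Lemma zcoaugE : coaug zcomplex 1 = \sum_q zbasis (n := 0%N) q.
Proof. by apply/ffunP => q; rewrite zbasis_pick ffunE. Qed.

Lemma zcobdE n (q : bindex dim n) : cobd zcomplex n (zbasis q) =
  \sum_(r : bindex dim n.+1 | in_delta_plus dim (val q) (val r)) zbasis r
  - \sum_(s : bindex dim n.+1 | in_delta_minus dim (val q) (val s)) zbasis s.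
Proof.
have E s (r : bindex dim n.+1) : (ibd s r == q) = bnd s (val q) (val r).
  have rn : dim (val r) = n.+1 by case: (r) => r' /= /eqP.
  have qn : dim (val q) = n by case: (q) => q' /= /eqP.
  have := faceE s (val q) (val r); rewrite /face rn qn eqxx /= => ->.
  by rewrite eq_sym.
apply/ffunP => r; rewrite ffunE [RHS]ffunE [in RHS]ffunE.
rewrite (zbasis_pick (fun r : bindex dim n.+1 => in_delta_plus dim (val q) (val r))).
rewrite (zbasis_pick (fun r : bindex dim n.+1 => in_delta_minus dim (val q) (val r))).
by rewrite !ffunE !E.
Qed.

Definition zdisc : disc_complex :=
  @DiscComplex zcomplex (zlast z) dim zbasis zbasisP (zdim_first z)
    (zdim_last z) (@zdim_step z) zcoaugE zcobdE.

Lemma zdiscK : disc_zigzag zdisc = z.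
Proof. by rewrite /disc_zigzag /=; case: z. Qed.

End DiscOf.

Lemma gstepP (G : globular_set) (x y : G) : gstep x y ->
  (0 < gdim y /\ x = bd minus y) \/ (0 < gdim x /\ y = bd plus x).
Proof. by case=> w w0; [left | right]. Qed.

(** The elements of a simple globular set are ranked by counting predecessors. *)
Lemma simple_rank (G : globular_set) : simple_globular_set G ->
  exists n (e : 'I_n.+1 -> G) (rk : G -> 'I_n.+1),
    [/\ cancel e rk, cancel rk e
      & forall x y, clos_trans G (@gstep G) x y <-> rk x < rk y].
Proof.
set R := clos_trans G (@gstep G) => -[[x0]] [n /card_set_bijP[f fbij]] [Rirr Rtr Rtot].
have fn x : f x < n by exact: (set_bij_sub fbij).
have finj : injective f.
  by move=> x y fxy; apply: (set_bij_inj fbij); rewrite ?in_setT.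
have fsurj (i : 'I_n) : {x | f x = i}.
  apply: cid; have [x _ <-] := set_bij_surj fbij (ltn_ord i : `I_n (i : nat)).
  by exists x.
pose g (i : 'I_n) := sval (fsurj i).
have fg i : f (g i) = i by exact: svalP (fsurj i).
have gf x : g (Ordinal (fn x)) = x by apply: finj; rewrite fg.
pose below x := finset.finset (fun i : 'I_n => `[< R (g i) x >]).
have inb x i : (i \in below x) = `[< R (g i) x >] by rewrite finset.in_set.
have sub x y : R x y -> below x \proper below y.
  move=> xy; apply/properP; split.
    apply/fintype.subsetP => i; rewrite !inb => /asboolP ix; apply/asboolP.
    exact: Rtr ix xy.
  exists (Ordinal (fn x)); rewrite inb gf; first exact/asboolP.
  by apply/asboolP; exact: Rirr.
have rkn x : #|below x| < n.
  rewrite -[X in _ < X]card_ord; apply/proper_card/properP.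
  split; first by apply/fintype.subsetP => i.
  by exists (Ordinal (fn x)); rewrite // inb gf; apply/asboolP; exact: Rirr.
case: n => [|n] in f fbij fn finj fsurj g fg gf below inb sub rkn *.
  by have := fn x0.
pose rk x : 'I_n.+1 := Ordinal (rkn x).
have rkR x y : R x y <-> rk x < rk y.
  split=> [/sub /proper_card //|lt]; case: (Rtot x y) => // [e|/sub /proper_card yx].
    by move: lt; rewrite e ltnn.
  by have := ltn_trans yx (lt : #|below x| < #|below y|); rewrite ltnn.
have rkinj : injective (rk \o g).
  move=> i j /= e; have ne u v : rk u = rk v -> u = v.
    move=> euv; case: (Rtot u v) => // /rkR; by rewrite euv ltnn.
  by apply: val_inj; rewrite /= -(fg i) -(fg j) (ne _ _ e).
exists n, (fun i => g (invF rkinj i)), rk; split=> // [i|x].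
  exact: (f_invF rkinj).
by rewrite -[x in rk x]gf -[rk _]/((rk \o g) _) invF_f gf.
Qed.

(** Suppose that the predecessor of [x] is higher than [x], so that [x] is its
    target. By globularity the source of [x] is then a twofold iterated source of
    the predecessor, to which induction applies; otherwise the predecessor is
    the source of [x]. Targets are dual. *)
Lemma bd_of_succ (z : zigzag) (G : globular_set) (e : zglob z -> G) :
  (forall x, gdim (e x) = gdim x) ->
  (forall q r : 'I_(zlast z).+1, r = q.+1 :> nat -> gstep (e q) (e r)) ->
  forall a x, 0 < gdim x -> e (bd a x) = bd a (e x).
Proof.
move=> edim succ.
have up (q r : 'I_(zlast z).+1) : r = q.+1 :> nat ->
    zdim r = (zdim q).+1 -> q = zbd minus r /\ e q = bd minus (e r).
  move=> rq d; split.
    have /= [[r0 h]|[q0 h]] := gstepP (zgstep_succ rq); first exact: h.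
    by move: d; rewrite h zbd_dim //; lia.
  have [[r0 //]|[q0 h]] := gstepP (succ _ _ rq).
  by have := gdim_bd plus q0; rewrite -h !edim /= d; lia.
have down (q r : 'I_(zlast z).+1) : r = q.+1 :> nat ->
    zdim q = (zdim r).+1 -> r = zbd plus q /\ e r = bd plus (e q).
  move=> rq d; split.
    have /= [[r0 h]|[q0 h]] := gstepP (zgstep_succ rq); last exact: h.
    by move: d; rewrite h zbd_dim //; lia.
  have [[r0 h]|[q0 //]] := gstepP (succ _ _ rq).
  by have := gdim_bd minus r0; rewrite -h !edim /= d; lia.
have minusE (x : 'I_(zlast z).+1) : 0 < zdim x -> e (zbd minus x) = bd minus (e x).
  have [j] : exists j, x <= j by exists x.
  elim: j x => [|j IH] x xj x0.
    by move: x0; have -> : x = ord0 by [apply: val_inj => /=; lia]; rewrite zdim_first.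
  have [e0|xpos] := posnP x; first by apply: IH; rewrite ?e0.
  have lt : x.-1 < (zlast z).+1 by have := ltn_ord x; lia.
  pose q := Ordinal lt.
  have xq : x = q.+1 :> nat by rewrite /= prednK.
  have [d|d] := zdim_step xq; first by have [<- <-] := up q x xq d.
  have [hx hex] := down q x xq d.
  have q0 : 0 < zdim q by lia.
  have lt1 := bnd_side (zbd_bnd minus q0).
  have bb := @bd_bd (zglob z) minus q (ltac:(rewrite /=; lia)).
  have bb' := @bd_bd G minus (e q) (ltac:(rewrite edim /=; lia)).
  rewrite /= in bb; rewrite hex -bb' hx -bb.
  rewrite -(IH q) //; last by rewrite /=; lia.
  by apply: IH; [move: lt1 => /=; lia | rewrite zbd_dim //; lia].
have plusE (x : 'I_(zlast z).+1) : 0 < zdim x -> e (zbd plus x) = bd plus (e x).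
  have [j] : exists j, zlast z - x <= j by exists (zlast z - x).
  elim: j x => [|j IH] x xj x0.
    move: x0; have -> : x = ord_max.
      by apply: val_inj => /=; have := ltn_ord x; lia.
    by rewrite zdim_last.
  have [xn|xn] := ltnP x (zlast z); last by apply: IH => //; lia.
  pose q : 'I_(zlast z).+1 := Ordinal (xn : x.+1 < (zlast z).+1).
  have qx : q = x.+1 :> nat by [].
  have [d|d] := zdim_step qx; last by have [<- <-] := down x q qx d.
  have [hx hex] := up x q qx d.
  have q0 : 0 < zdim q by lia.
  have lt1 := bnd_side (zbd_bnd plus q0).
  have bb := @bd_bd (zglob z) plus q (ltac:(rewrite /=; lia)).
  have bb' := @bd_bd G plus (e q) (ltac:(rewrite edim /=; lia)).
  rewrite /= in bb; rewrite hex bb' hx bb.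
  rewrite -(IH q) //; last by rewrite /=; lia.
  by apply: IH; [move: lt1 => /=; lia | rewrite zbd_dim //; lia].
by case=> x; [exact: minusE | exact: plusE].
Qed.

(** Neighbours in the total order of a simple globular set are related by a
    single step, which changes the dimension by one. *)
Lemma simple_zigzag (G : globular_set) : simple_globular_set G ->
  exists (z : zigzag) (e : zglob z -> G) (rk : G -> zglob z),
    [/\ cancel e rk, cancel rk e, forall x, gdim (e x) = gdim x
      & forall a x, 0 < gdim x -> e (bd a x) = bd a (e x)].
Proof.
move=> /simple_rank[n [e [rk [eK rkK rkR]]]].
have step_rk (x y : G) : gstep x y -> rk x < rk y.
  by move=> xy; apply/rkR; exact: t_step.
have succ (q r : 'I_n.+1) : r = q.+1 :> nat -> gstep (e q) (e r).
  move=> rq; have : clos_trans G (@gstep G) (e q) (e r) by apply/rkR; rewrite !eK rq.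
  have none w : rk (e q) < rk w -> rk w < rk (e r) -> False by rewrite !eK rq; lia.
  move: none; move: (e q) (e r) => u v none uv.
  case: uv none => [//|w y /rkR uw /rkR wy none].
  by case: (none w).
have first0 : gdim (e ord0) = 0.
  apply/eqP; rewrite -leqn0 leqNgt; apply/negP => g0.
  by have := step_rk _ _ (Gstep_minus g0); rewrite eK.
have last0 : gdim (e ord_max) = 0.
  apply/eqP; rewrite -leqn0 leqNgt; apply/negP => g0.
  have := step_rk _ _ (Gstep_plus g0); rewrite eK /=.
  by have := ltn_ord (rk (bd plus (e ord_max))); lia.
have dstep (q r : 'I_n.+1) : r = q.+1 :> nat ->
    gdim (e r) = (gdim (e q)).+1 \/ gdim (e q) = (gdim (e r)).+1.
  by move=> /succ /gstepP [[g0 ->]|[g0 ->]]; rewrite gdim_bd //; lia.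
pose z := @Zigzag n (fun i => gdim (e i)) first0 last0 dstep.
exists z, (e : zglob z -> G), rk; split=> //.
exact: (@bd_of_succ z G e).
Qed.

(** * Uniqueness of free omega-categories and the equivalence *)

Lemma free_transport (G G' : globular_set) (e : G' -> G) (rk : G -> G')
    (X : omega_cat) :
  cancel e rk -> cancel rk e -> (forall x, gdim (e x) = gdim x) ->
  (forall a x, 0 < gdim x -> e (bd a x) = bd a (e x)) ->
  is_free_omega_cat G X -> is_free_omega_cat G' X.
Proof.
move=> eK rkK edim ebd [i [irel iuniv]]; exists (i \o e); split.
  split=> [a x|a x x0] /=; first by rewrite -edim irel.1.
  by rewrite -edim irel.2 ?edim // ebd.
move=> D f frel.
have rkdim x : gdim (rk x) = gdim x by rewrite -edim rkK.
have [|F [FE Funiq]] := iuniv D (f \o rk).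
  split=> [a x|a x x0] /=; first by rewrite -rkdim frel.1.
  rewrite -rkdim frel.2 ?rkdim //; congr f.
  by apply: (can_inj eK); rewrite rkK ebd ?rkK ?rkdim.
exists F; split=> [x|H HE]; first by rewrite /= FE /= eK.
by apply: Funiq => x; rewrite -[x in LHS]rkK; exact: HE.
Qed.

Lemma free_unique (G : globular_set) (X Y : omega_cat) :
  is_free_omega_cat G X -> is_free_omega_cat G Y ->
  exists (F : omega_functor X Y) (H : omega_functor Y X),
    omega_comp H F = omega_id X /\ omega_comp F H = omega_id Y.
Proof.
move=> [i [irel iuniv]] [j [jrel juniv]].
have [F [FE _]] := iuniv Y j jrel; have [H [HE _]] := juniv X i irel.
exists F, H; split.
  have [K [_ Kuniq]] := iuniv X i irel.
  have <- : K = omega_comp H F by apply: Kuniq => x; rewrite /= FE HE.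
  by apply: Kuniq.
have [K [_ Kuniq]] := juniv Y j jrel.
have <- : K = omega_comp F H by apply: Kuniq => x; rewrite /= HE FE.
by apply: Kuniq.
Qed.

Lemma disc_functor_esurj (X : opposite Theta) :
  exists (A : disc_complexes) (u : hom (disc_functor A) X)
    (v : hom X (disc_functor A)),
    comp v u = idm (disc_functor A) /\ comp u v = idm X.
Proof.
case: X => X simpleX; have [G [simpleG freeG]] := simpleX.
have [z [e [rk [eK rkK edim ebd]]]] := simple_zigzag simpleG.
have := free_transport eK rkK edim ebd freeG; rewrite -(zdiscK z) => Xfree.
have [F [H [HF FH]]] := free_unique Xfree (zcells_free (disc_zigzag (zdisc z))).
by exists (zdisc z), F, H.
Qed.

Theorem mainTheorem3 : equivalent_categories (opposite Theta) disc_complexes.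
Proof.
apply: (equivalence_of_fully_faithful (F := disc_functor)).
- exact: disc_functor_faithful.
- exact: disc_functor_full.
- exact: disc_functor_esurj.
Qed.
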